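(* Let $G$ be a finite group. If, for each odd prime number $p$, the group $G$ has at most $p^2$ Sylow $p$-subgroups, then $G$ is solvable.
   Context: If $p$ does not divide $|G|$, the trivial subgroup is the unique Sylow $p$-subgroup of $G$, so the hypothesis is a condition only on the odd primes dividing $|G|$. *)

(* Defs.v *)
From mathcomp Require Import all_boot.

(* Main.v *)
Require Import Defs.
From mathcomp Require Import all_boot all_fingroup all_solvable.
From mathcomp Require Import integral_char.
From mathcomp Require Import zify.

(** Sylow numbers do not increase when passing to subgroups and quotients, so in a minimal
    counterexample [G] is a nonabelian simple group all of whose proper subgroups are solvable.
    Let [p] be the smallest odd prime dividing [#|G|] and let [n] be the number of Sylow
    [p]-subgroups. Write [Omega] for the set of these subgroups, on which [G] acts by
    conjugation.

    Since [n] is 1 modulo [p], the bound gives [n = 1 + k * p] with [k < p]. So each Sylow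
    subgroup [P] has [k] orbits on the other points, all of length [p]
    ([card_Sylow_orbit_join]). Four consequences follow.
    - [P] meets any other Sylow subgroup in index [p], and is abelian ([Sylow_abelian]).
    - An element of prime order [q > p] normalising [P] permutes fewer than [q] orbits of
      length less than [q], so it acts trivially ([norm_Sylow_larger]). Hence every prime
      [q > p] dividing [#|G|] divides [n <= p ^ 2], and only to the first power: there is at
      most one. By Burnside's theorem on groups of order [p ^ a * q ^ b] there is exactly one,
      called [r], and then [#|G| = 2 ^ a * p ^ b * r] and [n = 2 ^ c * r]
      ([order_three_primes]).
    - The normaliser of [P] is a maximal subgroup ([norm_Sylow_maximal]).
    - A [p']-subgroup normalised by [P] and fixing a point of [Omega] centralises [P]
      ([p'group_fix_cent]).

    Burnside's other theorem, that the size of a nontrivial conjugacy class of a nonabelian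
    simple group is divisible by two primes, controls centralisers throughout.

    If [c = 0], a Sylow 2-subgroup [S] normalises some [P]. The last consequence above forces
    [P] to have order [p], and the theorem on class sizes makes [S] act faithfully on [P]. So
    [S] is cyclic and contains the centralisers of its nontrivial elements; counting elements
    of prime power order gives more than [#|G|] of them ([not_prime_degree]).

    If [c > 0], the number of points other than [P] is odd, so a Sylow 2-subgroup of the
    normaliser of [P] fixes a second point; with maximality this gives [#|P| = p] and makes
    the 2-part of the centraliser of [P] cyclic. Also [P] cannot normalise a subgroup of order
    [r], so no proper subgroup has order divisible by [p * r] ([no_pr_subgroup]). Let [Y] have
    order [p] or [r] and lie in a proper subgroup that does not normalise [Y]. Passing to a
    maximal subgroup, whose Fitting subgroup is then a 2-group, produces an elementary abelian
    2-group [E] on which [Y] acts without fixed points. As [E] meets point stabilisers in order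
    at most 2, counting orbits gives [#|E| = 2 ^ c.+1 = #|Y|.+1], which arithmetic excludes
    ([no_regular_abelem]). So every proper subgroup containing [Y] normalises [Y]
    ([proper_sub_norm]).

    Finally let [z] be an involution in the centre of a Sylow 2-subgroup [S]. Its centraliser
    is [S], and every conjugate of [z] lies in a unique Sylow 2-subgroup
    ([class_Sylow_unique]). Two distinct conjugates [x] and [y] of [z] generate a proper
    subgroup that is not a 2-group, hence normalises some [Y] as above, and [x^-1 * y] lies in
    [Y]. Conversely [x * w] is a conjugate of [z] whenever [w] lies in some [Y] normalised by
    [x]. Counting the [p * r] conjugates of [z] this way
    gives [p * r = 1 + a * (p - 1) + b * (r - 1)], where [a] is 0 or [n / r] and [b] is 0 or
    the number of Sylow [r]-subgroups divided by [p]. Congruences modulo [p] and [r] show that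
    [p * r] divides [a + b], which is too small ([class_equation_absurd]). *)

Set Implicit Arguments.
Unset Strict Implicit.
Unset Printing Implicit Defensive.

(** * Arithmetic *)

(** In a group of order [s * (p * r)], the right-hand side counts the conjugates of the
    nontrivial elements of three subgroups that meet their conjugates trivially: one of order
    [s] that is its own normaliser, one of order [p] with [r] conjugates and one of order [r]
    with [n] conjugates. *)
Lemma three_supports_ineq (s p r n : nat) : 0 < s -> 1 < p -> 1 < r -> 1 < n ->
  (s * (p * r)).-1 < s.-1 * (p * r) + p.-1 * r + r.-1 * n.
Proof.
move=> s_gt0 p_gt1 r_gt1 n_gt1.
have: s * (p * r) = s.-1 * (p * r) + p.-1 * r + r :> nat.
  by rewrite -addnA -mulSnr prednK ?(ltnW p_gt1) // -mulSnr prednK.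
have: r.-1 * 2 <= r.-1 * n by rewrite leq_mul2l n_gt1 orbT.
move: (s * _)%N (s.-1 * _)%N (p.-1 * _)%N (r.-1 * n)%N; clear -r_gt1; lia.
Qed.

(** Multiplying [2 ^ c * r] by 2 gives [r] is 2 modulo [p], hence [r = p + 2]; but 3 divides
    one of [p], [p + 1], [p + 2]. *)
Lemma twin_degree_absurd (p r c : nat) :
    prime p -> prime r -> 3 < p -> p < r -> odd r -> p.+1 = 2 ^ c.+1 ->
    (2 ^ c * r) %% p = 1 -> 2 ^ c * r <= p ^ 2 ->
  False.
Proof.
move=> p_pr r_pr p_gt3 ltpr odd_r def_p n_mod n_le.
have def_r : r = p + 2.
  have eq2n: p.+1 * r = 2 * (2 ^ c * r) by rewrite def_p expnS mulnA.
  have ltr2p: r < 2 * p by rewrite -mulnn in n_le; move: eq2n n_le; clear -p_gt3; nia.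
  have r_mod: r %% p = 2.
    transitivity ((p.+1 * r) %% p); first by rewrite mulSn addnC mulnC modnMDl.
    by rewrite eq2n -modnMmr n_mod muln1 modn_small // ltnW.
  have: (r - p) %% p = 2 by rewrite -r_mod -{2}(subnKC (ltnW ltpr)) modnDl.
  by rewrite modn_small; clear -ltpr ltr2p; lia.
have odd3 q : prime q -> 3 < q -> 0 < q %% 3.
  move=> q_pr q_gt3; rewrite lt0n; apply/negP.
  by rewrite -/(3 %| q) dvdn_prime2 // ltn_eqF.
have := odd3 p p_pr p_gt3; have := odd3 r r_pr (ltn_trans p_gt3 ltpr).
have: ~~ (3 %| p.+1) by rewrite def_p Euclid_dvdX.
by rewrite def_r; clear; lia.
Qed.

(** Modulo [p] the product [r * (r + 1)] is 2, that is, [p] divides [(r + 2) * (r - 1)]. By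
    parity the cofactor is large enough to give [2 * p <= r], against the size bound. *)
Lemma mersenne_degree_absurd (p r c : nat) :
    prime p -> odd p -> odd r -> p < r -> r.+1 = 2 ^ c.+1 ->
    (2 ^ c * r) %% p = 1 -> 2 ^ c * r <= p ^ 2 ->
  False.
Proof.
move=> p_pr odd_p odd_r ltpr def_r n_mod n_le.
have eq2n: r.+1 * r = 2 * (2 ^ c * r) by rewrite def_r expnS mulnA.
have p_gt1 := prime_gt1 p_pr.
have: p %| r.+2 * r.-1.
  have eq2: r.+2 * r.-1 + 2 = 2 * (2 ^ c * r).
    by rewrite -eq2n; case: (r) ltpr => // s _; rewrite succnK; clear; lia.
  apply/dvdnP; exists (2 * (2 ^ c * r %/ p)).
  have := divn_eq (2 ^ c * r) p; rewrite n_mod => def_A; move: eq2.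
  by rewrite {1}def_A -mulnA; move: (_ * p) (_ * r.-1); clear; lia.
rewrite Euclid_dvdM // => p_dv.
have ge_2p: 2 * p <= r.
  case/orP: p_dv => /dvdnP[m def_m].
    have m_gt2: 2 < m.
      case: m def_m => [|[|[|]]] //; rewrite ?mul1n ?mul0n.
      - by clear -ltpr; lia.
      - by move/(congr1 odd); rewrite oddM /= odd_r.
    have: 3 * p <= m * p by rewrite leq_mul2r m_gt2 orbT.
    by rewrite -def_m; clear -p_gt1; lia.
  have m_gt1: 1 < m.
    case: m def_m => [|[|]] //; rewrite ?mul1n ?mul0n; first by clear -ltpr p_gt1; lia.
    by move=> def_p; move: odd_p; rewrite -def_p; case: (r) odd_r => //= s /negPf->.
  have: 2 * p <= m * p by rewrite leq_mul2r m_gt1 orbT.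
  by rewrite -def_m; clear; lia.
have: (2 * p) * (2 * p) <= r.+1 * r by rewrite leq_mul // ltnW.
rewrite eq2n; move: n_le; rewrite -mulnn mulnACA.
have: 0 < p * p by rewrite muln_gt0 ltnW.
by move: (p * p) (2 ^ c * r); clear; lia.
Qed.

(** Multiplying the equation by [r] and reducing modulo [p], or by [p] and reducing modulo [r],
    turns each congruence into a divisibility of [a + b], by [p] and by [r]. *)
Lemma class_equation_absurd (p r a b : nat) :
    prime p -> prime r -> 2 < p -> p < r ->
    p * r = (a * p.-1 + b * r.-1).+1 -> a * r <= p ^ 2 -> a != 1 ->
    a = 0 \/ (a * r) %% p = 1 -> b = 0 \/ (b * p) %% r = 1 ->
  False.
Proof.
move=> p_pr r_pr p_gt2 ltpr eqE le_ar neq_a1 a_mod b_mod.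
have lt_ap: a < p.
  rewrite -(ltn_pmul2r (prime_gt0 r_pr)) (leq_ltn_trans le_ar) // -mulnn.
  by rewrite ltn_pmul2l ?prime_gt0.
have r_dvd : (b * p) %% r = 1 -> r %| p.-1 * (a * p).+1.
  move=> b1; have := divn_eq (b * p) r; rewrite b1; move: (_ %/ r) => v def_bp.
  have eq2: p * (p * r) = p.-1 * (a * p).+1 + (v * r.-1).+1 * r.
    rewrite eqE; move: def_bp.
    rewrite -(prednK (prime_gt0 p_pr)) -(prednK (prime_gt0 r_pr)) !succnK.
    clear; nia.
  by rewrite -(dvdn_addl _ (dvdn_mull (v * r.-1).+1 (dvdnn r))) -eq2 mulnA dvdn_mull.
have p_dvd : (a * r) %% p = 1 -> p %| r.-1 * (b * r).+1.
  move=> a1; have := divn_eq (a * r) p; rewrite a1; move: (_ %/ p) => u def_ar.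
  have eq2: r * (p * r) = r.-1 * (b * r).+1 + (u * p.-1).+1 * p.
    rewrite eqE; move: def_ar.
    rewrite -(prednK (prime_gt0 p_pr)) -(prednK (prime_gt0 r_pr)) !succnK.
    clear; nia.
  by rewrite -(dvdn_addl _ (dvdn_mull (u * p.-1).+1 (dvdnn p))) -eq2 mulnCA dvdn_mulr.
(* The cases in which a or b vanishes contradict the sizes and the divisibility just found. *)
have r'p1: ~~ (r %| p.-1) by rewrite gtnNdvd //; clear -p_gt2 ltpr; lia.
case: b_mod => [b0 | b1].
  have: p * p.+1 <= p * r by rewrite leq_mul2l ltpr orbT.
  have: a * p.-1 <= p * p by rewrite leq_mul ?leq_pred // ltnW.
  rewrite eqE b0 mul0n addn0 mulnS; move: (p * p) (a * _).
  by clear -p_gt2; lia.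
have r_dv: r %| (a * p).+1 by have := r_dvd b1; rewrite Euclid_dvdM // (negPf r'p1).
case: a_mod => [a0 | a1].
  by move: r_dv; rewrite a0 mul0n dvdn1 => /eqP r1; rewrite r1 in r_pr.
have r_dv_s: r %| a + b.
  have : r %| p * (a + b).
    have [v def_bp]: exists v, b * p = v * r + 1.
      by exists (b * p %/ r); rewrite -b1 -divn_eq.
    by rewrite mulnC mulnDl def_bp addnCA addn1 dvdn_add // dvdn_mull.
  by rewrite Euclid_dvdM // gtnNdvd ?prime_gt0.
(* If p divides r - 1, then a = a * r = 1 modulo p, so a = 1. *)
have p'r1: ~~ (p %| r.-1).
  apply/negP=> p_dv; case/eqP: neq_a1.
  have : (a * r) %% p = a.
    rewrite -(prednK (prime_gt0 r_pr)) mulnS -modnDmr -modnMmr (eqP p_dv).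
    by rewrite muln0 mod0n addn0 modn_small.
  by rewrite a1.
have p_dv: p %| (b * r).+1 by have := p_dvd a1; rewrite Euclid_dvdM // (negPf p'r1).
have p_dv_s: p %| a + b.
  have : p %| r * (a + b).
    have [u def_ar]: exists u, a * r = u * p + 1.
      by exists (a * r %/ p); rewrite -a1 -divn_eq.
    by rewrite mulnC mulnDl def_ar -addnA add1n dvdn_add // dvdn_mull.
  by rewrite Euclid_dvdM // dvdn_prime2 // ltn_eqF.
have: p * r %| a + b.
  by rewrite Gauss_dvd ?p_dv_s // prime_coprime // dvdn_prime2 // ltn_eqF.
have b_gt0: 0 < b by rewrite lt0n; apply/eqP=> b0; rewrite b0 mul0n mod0n in b1.
have le_a: a * 2 <= a * p.-1 by rewrite leq_mul2l; clear -p_gt2; lia.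
have le_b: b * 2 <= b * r.-1 by rewrite leq_mul2l; clear -p_gt2 ltpr; lia.
move/dvdn_leq; rewrite addn_gt0 b_gt0 orbT => /(_ isT); rewrite eqE.
by move: le_a le_b; move: (a * p.-1) (b * r.-1); clear -b_gt0; lia.
Qed.

Lemma modn1_between (q e : nat) : q < e -> e < 2 * q -> e %% q = 1 -> e = q.+1.
Proof.
move=> lt_qe lt_e2q e_mod; have: (e - q) %% q = 1.
  by rewrite -e_mod -{2}(subnKC (ltnW lt_qe)) modnDl.
by rewrite modn_small; clear -lt_qe lt_e2q; lia.
Qed.

(** * Sylow numbers of subgroups and quotients *)

Local Open Scope group_scope.

(** Every Sylow subgroup of [H] is cut out on [H] by one of [G]. *)
Lemma card_Syl_sub (gT : finGroupType) (p : nat) (H G : {group gT}) :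
  H \subset G -> #|'Syl_p(H)| <= #|'Syl_p(G)|.
Proof.
move=> sHG; pose f (Q : {group gT}) := (Q :&: H)%G.
suff sub: 'Syl_p(H) \subset f @: 'Syl_p(G).
  exact: leq_trans (subset_leq_card sub) (leq_imset_card _ _).
apply/subsetP=> P; rewrite inE => sylP.
have [sPH pP _] := and3P sylP.
have [Q sylQ sPQ] := Sylow_superset (subset_trans sPH sHG) pP.
apply/imsetP; exists Q; first by rewrite inE.
have pQH: p.-group (Q :&: H) := pgroupS (subsetIl _ _) (pHall_pgroup sylQ).
have sPQH: P \subset Q :&: H by rewrite subsetI sPQ.
by apply/val_inj/esym/(sub_pHall sylP pQH sPQH (subsetIr _ _)).
Qed.

(** Every Sylow subgroup of the quotient is the image of one of [G]. *)
Lemma card_Syl_quotient (gT : finGroupType) (p : nat) (G N : {group gT}) :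
  N <| G -> #|'Syl_p(G / N)| <= #|'Syl_p(G)|.
Proof.
move=> nsNG; pose f (Q : {group gT}) := (Q / N)%G.
suff sub: 'Syl_p(G / N) \subset f @: 'Syl_p(G).
  exact: leq_trans (subset_leq_card sub) (leq_imset_card _ _).
have [P sylP] := Sylow_exists p G.
have nNP: P \subset 'N(N) := subset_trans (pHall_sub sylP) (normal_norm nsNG).
apply/subsetP=> Q; rewrite inE => sylQ.
have [_ /morphimP[x nNx Gx ->] defQ] := Sylow_trans (quotient_pHall nNP sylP) sylQ.
apply/imsetP; exists (P :^ x)%G; first by rewrite inE pHallJ.
by apply/val_inj; rewrite /= defQ quotientJ.
Qed.

(** * Finite groups and their actions *)

(** A term of the derived series of the centraliser whose derived subgroup lies in the
    Fitting subgroup is nilpotent of class at most two, hence lies in it too. *)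
Lemma cent_sub_Fitting (gT : finGroupType) (G : {group gT}) :
  solvable G -> 'C_G('F(G)) \subset 'F(G).
Proof.
move=> solG; set C := 'C_G(_); have sCG: C \subset G := subsetIl _ _.
have nsCG: C <| G.
  have nFG: G \subset 'N('F(G)) := normal_norm (Fitting_normal G).
  by have := subcent_normal G 'F(G); rewrite (setIidPl nFG).
have /derivedP[n Cn1] := solvableS sCG solG.
have: C^`(n) \subset 'F(G) by rewrite Cn1 sub1G.
elim: n {Cn1} => // n IHn sC'F; apply: IHn.
have nsAG: C^`(n) <| G := gFnormal_trans _ nsCG.
have cAF: C^`(n) \subset 'C('F(G)) := subset_trans (der_sub n _) (subsetIr _ _).
apply: Fitting_max nsAG _; rewrite -quotient_center_nil abelian_nil //.
rewrite sub_der1_abelian // derg1 -dergSn subsetI der_subS /=.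
by rewrite (subset_trans sC'F) // centsC.
Qed.

Lemma cyclic_faithful_prime (gT : finGroupType) (U P : {group gT}) :
  prime #|P| -> U \subset 'N(P) -> 'C_U(P) = 1 -> cyclic U.
Proof.
move=> prP nPU regU; have injU: 'injm (restrm nPU (conj_aut P)).
  by rewrite ker_restrm ker_conj_aut regU.
rewrite -(injm_cyclic injU (subxx U)) morphim_restrm setIid.
exact: cyclicS (Aut_conj_aut P U) (Aut_prime_cyclic prP).
Qed.

Lemma prime_group_eq (gT : finGroupType) (P Q : {group gT}) x (p : nat) :
  prime p -> #|P| = p -> #|Q| = p -> x \in P -> x \in Q -> x != 1 -> P :=: Q.
Proof.
move=> p_pr oP oQ Px Qx ntx.
have gen (H : {group gT}) : #|H| = p -> x \in H -> <[x]> = H.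
  move=> oH Hx; apply/eqP; rewrite eqEcard cycle_subG Hx oH.
  have: #[x] %| p by rewrite -oH order_dvdG.
  have /primeP[_ dvp] := p_pr; move/dvp; rewrite order_eq1 (negPf ntx).
  by rewrite /= -orderE => /eqP->.
by rewrite -(gen P) // -(gen Q).
Qed.

Lemma normedTI_prime (gT : finGroupType) (G Q : {group gT}) :
  prime #|Q| -> Q \subset G -> normedTI Q^# G 'N_G(Q).
Proof.
move=> prQ sQG; apply/normedTI_P; split=> [||g Gg].
- by rewrite setD_eq0 subG1 -cardG_gt1 prime_gt1.
- by rewrite normD1.
case/pred0Pn=> x /andP[/setD1P[ntx Qx]]; rewrite conjD1g => /setD1P[_ Qgx].
have oQg: #|(Q :^ g)%G| = #|Q| by rewrite cardJg.
rewrite in_setI Gg; apply/normP/esym.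
exact: (prime_group_eq prQ (erefl _) oQg Qx Qgx ntx).
Qed.

Lemma class_support_elt (gT : finGroupType) (G H : {group gT}) (p : nat) x :
  p.-group H -> x \in class_support H^# G -> p.-elt x && (x != 1).
Proof.
move=> pH /imset2P[h g /setD1P[nth Hh] _ ->].
by rewrite p_eltJ (mem_p_elt pH Hh) conjg_eq1.
Qed.

Lemma class_support_TI (gT : finGroupType) (G H K : {group gT}) (p q : nat) :
    prime p -> prime q -> p != q -> p.-group H -> q.-group K ->
  class_support H^# G :&: class_support K^# G = set0.
Proof.
move=> p_pr q_pr neq_pq pH qK; apply/setP=> x; rewrite in_setI in_set0.
apply/andP=> -[/(class_support_elt pH)/andP[p_x ntx] /(class_support_elt qK)/andP[q_x _]].
case/negP: ntx; rewrite -order_eq1; apply/eqP/(@pnat_1 p) => //.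
by apply: pi_pnat q_x _; rewrite !inE eq_sym.
Qed.

(** Orbit lengths are powers of [p]. *)
Lemma pgroup_small_set_fix (aT : finGroupType) (T : finType) (to : {action aT &-> T})
    (p : nat) (A : {group aT}) (X : {set T}) :
  prime p -> p.-group A -> [acts A, on X | to] -> #|X| < p -> X \subset 'Fix_to(A).
Proof.
move=> p_pr pA nXA ltXp; apply/subsetP=> x Xx.
have sox: orbit to A x \subset X by rewrite acts_sub_orbit.
have dv_ox: #|orbit to A x| %| #|A| by rewrite dvdn_orbit.
have [k def_ox] := p_natP (pnat_dvd dv_ox pA).
case: k def_ox => [/card_orbit1 ox | k def_ox]; last first.
  have := leq_ltn_trans (subset_leq_card sox) ltXp.
  by rewrite def_ox -{2}[p]expn1 ltn_exp2l ?prime_gt1.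
by apply/afixP=> a Aa; apply/set1P; rewrite -ox mem_orbit.
Qed.

Lemma Syl_normP (gT : finGroupType) (p : nat) (G P Q : {group gT}) :
  p.-Sylow(G) P -> p.-Sylow(G) Q -> P \subset 'N(Q) -> P :=: Q.
Proof.
move=> sylP sylQ nQP.
have [sPG pP _] := and3P sylP; have [sQG pQ _] := and3P sylQ.
have pPQ: p.-group (P <*> Q).
  by rewrite /= norm_joinEl // pgroupM pP.
have sPQG: P <*> Q \subset G by rewrite join_subG sPG.
apply: etrans (sub_pHall sylQ pPQ (joing_subr _ _) sPQG).
exact/esym/(sub_pHall sylP pPQ (joing_subl _ _) sPQG).
Qed.

Lemma cyclic_abelem_leq (gT : finGroupType) (E : {group gT}) (p : nat) :
  prime p -> p.-abelem E -> cyclic E -> #|E| <= p.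
Proof.
move=> p_pr abE cyE; have [-> | ntE] := eqVneq (E : {set gT}) 1.
  by rewrite cards1 prime_gt0.
by rewrite (cyclic_abelem_prime abE cyE ntE).
Qed.

(** When [q] divides [#|G|] exactly once, Sylow [q]-subgroups may be found inside any subgroup
    of order divisible by [q]. *)
Lemma prime_Sylow_sub (gT : finGroupType) (G H Y : {group gT}) (q : nat) :
    prime q -> (#|G|`_q)%N = q -> H \subset G -> q %| #|H| -> q.-Sylow(H) Y ->
  q.-Sylow(G) Y.
Proof.
move=> q_pr oGq sHG q_dv sylY; rewrite pHallE (subset_trans (pHall_sub sylY) sHG) /=.
rewrite (card_Hall sylY) oGq eqn_dvd -{2}oGq partn_dvd ?cardSg //=.
by rewrite p_part dvdn_exp // logn_gt0 mem_primes q_pr cardG_gt0.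
Qed.

Lemma normal_Sylow_factor (gT : finGroupType) (H Y U : {group gT}) (q : nat) :
    prime q -> q != 2 -> (forall s, prime s -> s %| #|H| -> s \in [:: 2; q]) ->
    q.-Sylow(H) Y -> 2.-Sylow(H) U -> Y * U = H.
Proof.
move=> q_pr neq_q2 piH sylY sylU.
have oH: #|H| = (#|U| * #|Y|)%N.
  rewrite (card_Hall sylU) (card_Hall sylY) -{1}(partnC 2 (cardG_gt0 H)).
  congr (_ * _)%N; apply: eq_in_partn => s; rewrite mem_primes => /and3P[s_pr _ s_dv].
  have := piH s s_pr s_dv; rewrite !inE => /orP[] /eqP->; last by rewrite eqxx.
  by rewrite eq_sym (negPf neq_q2).
have co_YU: coprime #|Y| #|U|.
  have [k ->] := p_natP (pHall_pgroup sylY); have [m ->] := p_natP (pHall_pgroup sylU).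
  by rewrite coprimeXl // coprimeXr // prime_coprime // dvdn_prime2.
apply/eqP; rewrite eqEcard mul_subG ?(pHall_sub sylY) ?(pHall_sub sylU) //=.
by rewrite coprime_cardMg // mulnC oH.
Qed.

Lemma card_bigcup_prime (gT : finGroupType) (F : {set {group gT}}) (q : nat) :
  prime q -> {in F, forall Y : {group gT}, #|Y| = q} ->
  #|\bigcup_(Y in F) Y^#| = (#|F| * q.-1)%N.
Proof.
move=> q_pr oF; pose P := [set (Y : {group gT})^# | Y in F].
have injF: {in F &, injective (fun Y : {group gT} => Y^#)}.
  move=> Y1 Y2 _ _ /= eqY; apply/val_inj; rewrite /= -(setD1K (group1 Y1)) eqY.
  by rewrite setD1K.
have oP A : A \in P -> #|A| = q.-1.
  by case/imsetP=> Y FY ->; have := cardsD1 1 Y; rewrite group1 oF // => ->.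
have partP: partition P (\bigcup_(Y in F) Y^#).
  apply/and3P; split.
  - by rewrite cover_imset.
  - apply/trivIsetP=> _ _ /imsetP[Y1 FY1 ->] /imsetP[Y2 FY2 ->] neqY.
    apply/pred0P=> x /=; apply/andP=> -[/setD1P[ntx Y1x] /setD1P[_ Y2x]].
    by case/eqP: neqY; rewrite (prime_group_eq q_pr (oF _ FY1) (oF _ FY2) Y1x Y2x ntx).
  apply/negP=> /oP; rewrite cards0; have := prime_gt1 q_pr; clear; lia.
by rewrite (card_uniform_partition oP partP) card_in_imset.
Qed.

(** * Nonabelian simple groups *)

Section SimpleGroup.

Variables (gT : finGroupType) (G : {group gT}).
Hypotheses (simG : simple G) (ncG : ~~ abelian G).

Lemma norm_eq_simple (H : {group gT}) :
  H :!=: 1 -> H \proper G -> 'N_G(H) \proper G.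
Proof.
move=> ntH prH; rewrite properEneq subsetIl andbT; apply/eqP => defG.
have [_ /(_ H)] := simpleP _ simG; case.
- by rewrite /normal proper_sub //= -{1}defG subsetIr.
- by move/eqP; rewrite (negPf ntH).
by move=> eqHG; rewrite eqHG properxx in prH.
Qed.

Lemma center_simple : 'Z(G) = 1.
Proof.
have [_ /(_ _ (center_normal G))[] // /center_idP] := simpleP _ simG.
by rewrite (negPf ncG).
Qed.

Lemma cent1_proper_simple x : x \in G -> x != 1 -> 'C_G[x] \proper G.
Proof.
move=> Gx ntx; rewrite properEneq subsetIl andbT; apply: contraNneq ntx => defG.
rewrite -in_set1 -[[set 1]]center_simple inE Gx /=.
by rewrite -sub_cent1 -{1}defG subsetIr.
Qed.

Lemma gcore_simple (H : {group gT}) : H \proper G -> gcore H G = 1.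
Proof.
move=> prH; have [sHG _] := andP prH.
have nsHG: gcore_group H G <| G.
  by rewrite /normal gcore_norm (subset_trans (gcore_sub _ _)).
have [_ /(_ _ nsHG)[//|defG]] := simpleP _ simG.
by have:= gcore_sub H G; rewrite [gcore H G]defG => /(proper_sub_trans prH); rewrite properxx.
Qed.

(** By Burnside the class of [x], whose size divides [p * q], involves both primes. *)
Lemma cent1_index_simple x (p q : nat) (H : {group gT}) :
  x \in G -> x != 1 -> H \subset 'C_G[x] -> prime p -> prime q ->
  #|G : H| = (p * q)%N -> 'C_G[x] = H.
Proof.
move=> Gx ntx sHC p_pr q_pr iGH; have sHG := subset_trans sHC (subsetIl _ _).
have /primes_class_simple_gt1 := simG => /(_ (x ^: G) ncG).
rewrite !inE classG_eq1 ntx mem_classes // => /(_ isT).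
rewrite -index_cent1; set i := #|G : _| => i_gt1.
have i_gt0: 0 < i by apply: indexg_gt0.
have def_pq: (i * #|'C_G[x] : H|)%N = (p * q)%N.
  by rewrite -iGH Lagrange_index ?subsetIl.
have sub_pq: {subset primes i <= [:: p; q]}.
  move=> s; rewrite mem_primes => /and3P[s_pr _ s_dv_i].
  have: s %| p * q by rewrite -def_pq dvdn_mulr.
  by rewrite Euclid_dvdM // !dvdn_prime2 // !inE.
have [_ eq_mem] := uniq_min_size (primes_uniq i) sub_pq i_gt1.
have /andP[neq_pq _] := leq_size_uniq (primes_uniq i) sub_pq i_gt1.
have [dv_p dv_q]: p %| i /\ q %| i.
  have := eq_mem p; have := eq_mem q.
  by rewrite !mem_primes !inE !eqxx ?orbT => /and3P[_ _ ->] /and3P[_ _ ->].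
have co_pq: coprime p q by rewrite prime_coprime // dvdn_prime2 // -[p == q]mem_seq1.
have dv_pq: p * q %| i by rewrite Gauss_dvd // dv_p.
have eq_i: i = (p * q)%N by apply/eqP; rewrite eqn_dvd dv_pq -def_pq dvdn_mulr.
have /eqP := def_pq; rewrite -eq_i -{2}[i]muln1 eqn_pmul2l // indexg_eq1 => sCH.
by apply/eqP; rewrite eqEsubset sCH.
Qed.

(** Otherwise the size of the class of [x] would divide [q]. *)
Lemma cent1_prime_index_simple x (q : nat) :
  x \in G -> x != 1 -> prime q -> ~~ (#|G| %| #|'C_G[x]| * q).
Proof.
move=> Gx ntx q_pr; apply/negP=> dvG.
have /primes_class_simple_gt1 := simG => /(_ (x ^: G) ncG).
rewrite !inE classG_eq1 ntx mem_classes // => /(_ isT).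
rewrite -(Lagrange (subsetIl G 'C[x])) dvdn_pmul2l // in dvG.
rewrite -index_cent1 ltnNge -(size_nseq 1 q) => /negP[].
apply: uniq_leq_size (primes_uniq _) _ => s.
rewrite mem_primes inE => /and3P[s_pr _ s_dv].
by rewrite -(dvdn_prime2 s_pr q_pr) (dvdn_trans s_dv).
Qed.

Lemma Sylow_proper p (P : {group gT}) : p.-Sylow(G) P -> P \proper G.
Proof.
move=> sylP; rewrite properEneq (pHall_sub sylP) andbT; apply: contra ncG.
move/eqP=> defP; have pG: p.-group G by rewrite -defP (pHall_pgroup sylP).
have := simple_sol_prime (pgroup_sol pG) simG.
by move/prime_cyclic/cyclic_abelian.
Qed.

Lemma Sylow_neq1 p (P : {group gT}) :
  prime p -> p %| #|G| -> p.-Sylow(G) P -> P :!=: 1.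
Proof.
move=> p_pr p_dv_G sylP; rewrite trivg_card1 (card_Hall sylP) p_part_eq1 mem_primes.
by rewrite p_pr cardG_gt0 p_dv_G.
Qed.

Lemma norm_Sylow_proper p (P : {group gT}) :
  prime p -> p %| #|G| -> p.-Sylow(G) P -> 'N_G(P) \proper G.
Proof.
move=> p_pr p_dv_G sylP.
by rewrite norm_eq_simple ?(Sylow_proper sylP) ?(Sylow_neq1 p_pr p_dv_G sylP).
Qed.

Lemma Syl_actsJ p (A : {group gT}) : A \subset G -> [acts A, on 'Syl_p(G) | 'JG].
Proof. by move=> sAG; apply: subset_trans sAG (atrans_acts (Syl_trans p G)). Qed.

Lemma Syl_gt1 p : prime p -> p %| #|G| -> 1 < #|'Syl_p(G)|.
Proof.
move=> p_pr p_dv_G; have [P sylP] := Sylow_exists p G.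
have prN := norm_Sylow_proper p_pr p_dv_G sylP.
by rewrite (card_Syl sylP) indexg_gt1; case/andP: prN.
Qed.

(** * At most p^2 Sylow p-subgroups *)

Section FewSylow.

Variable p : nat.
Hypotheses (p_pr : prime p) (p_dv_G : p %| #|G|) (few : #|'Syl_p(G)| <= p ^ 2).

Lemma Syl_acts_D1 (A P : {group gT}) :
  A \subset 'N_G(P) -> [acts A, on 'Syl_p(G) :\ P | 'JG].
Proof.
rewrite subsetI => /andP[sAG nPA].
have /subsetP actA := Syl_actsJ p sAG.
apply/subsetP=> a Aa; have := actA a Aa; rewrite !inE => /subsetP actAa.
have{} nPa: 'JG%act P a = P by apply/val_inj/(normsP nPA).
apply/subsetP=> Q; rewrite !inE => /andP[neqQP sylQ]; apply/andP; split.
  by apply: contra neqQP => /eqP/=; rewrite -[X in _ = X]nPa => /(act_inj 'JG%act)->.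
by have := actAa Q; rewrite !inE; apply.
Qed.

(** [P] is its own only fixed point in its action on the Sylow subgroups. *)
Lemma dvdn_Syl_D1 (P : {group gT}) (X : {set {group gT}}) :
    p.-Sylow(G) P -> [acts P, on X | 'JG] -> X \subset 'Syl_p(G) :\ P ->
  p %| #|X|.
Proof.
move=> sylP nXP sXD1; rewrite /dvdn (pgroup_fix_mod (pHall_pgroup sylP) nXP).
suff -> : 'Fix_(X | 'JG)(P) = set0 by rewrite cards0 mod0n.
apply/setP=> Q; rewrite in_setI in_set0 afixJG; apply/andP=> -[XQ nQP].
have := subsetP sXD1 Q XQ; rewrite !inE => /andP[neqQP sylQ].
by case/eqP: neqQP; apply/val_inj/esym/(Syl_normP sylP sylQ).
Qed.

Lemma card_Syl_D1 (P : {group gT}) : p.-Sylow(G) P -> #|'Syl_p(G) :\ P| < p ^ 2.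
Proof. by move=> sylP; have := cardsD1 P 'Syl_p(G); rewrite inE sylP; lia. Qed.

(** [P] permutes this orbit with [P] as its only fixed point. *)
Lemma card_orbit_normalised (P A : {group gT}) :
    p.-Sylow(G) P -> A \subset G -> P \subset 'N(A) ->
  #|orbit 'JG%act A P| %% p = 1%N.
Proof.
move=> sylP sAG nAP; have sPG := pHall_sub sylP.
pose X := orbit 'JG%act A P :&: ('Syl_p(G) :\ P).
have defX: X = orbit 'JG%act A P :\ P.
  apply/setP=> Q; rewrite in_setI !in_setD1 andbCA; congr (_ && _).
  by rewrite andb_idr // => /orbitP[x Ax <-]; rewrite inE pHallJ ?(subsetP sAG).
have p_dv_X: p %| #|X|.
  apply: dvdn_Syl_D1 sylP _ (subsetIr _ _); apply: actsI; last first.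
    by apply: Syl_acts_D1; rewrite subsetI sPG normG.
  have fixP y: y \in P -> 'JG%act P y = P by move=> Py; apply/val_inj/conjGid.
  apply/subsetP=> x Px; rewrite !inE; apply/subsetP=> _ /orbitP[a Aa <-].
  by rewrite inE actCJ fixP // mem_orbit // memJ_norm ?(subsetP nAP).
rewrite (cardsD1 P) orbit_refl -defX -modnDmr (eqP p_dv_X).
by rewrite modn_small ?prime_gt1.
Qed.

(** The size of the orbit is a multiple of [p], because [P] fixes no other Sylow subgroup,
    and it is less than [p ^ 2 < p * q]; so [q] does not divide it. As it divides
    [#|P| * #|Y|], it is a power of [p]. *)
Lemma card_Sylow_orbit_join (P Q Y : {group gT}) q :
    p.-Sylow(G) P -> p.-Sylow(G) Q -> P :!=: Q ->
    prime q -> p < q -> q.-group Y -> Y \subset 'N_G(P) ->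
  #|orbit 'JG%act (P <*> Y) Q| = p.
Proof.
move=> sylP sylQ neqPQ q_pr ltpq qY nPY; have [sYG nPY'] := subsetIP nPY.
have sPYN: P <*> Y \subset 'N_G(P).
  by rewrite join_subG nPY subsetI (pHall_sub sylP) normG.
have D1Q: Q \in 'Syl_p(G) :\ P by rewrite !inE sylQ andbT eq_sym.
have sXD1: orbit 'JG%act (P <*> Y) Q \subset 'Syl_p(G) :\ P.
  by rewrite acts_sub_orbit // Syl_acts_D1.
set X := orbit _ _ _ in sXD1 *.
have p_dv_X: p %| #|X|.
  apply: dvdn_Syl_D1 sylP _ sXD1; apply: subset_trans (joing_subl P Y) _.
  by rewrite acts_orbit ?subsetT.
have X_lt: #|X| < p ^ 2 := leq_ltn_trans (subset_leq_card sXD1) (card_Syl_D1 sylP).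
have X_dv: #|X| %| #|P| * #|Y|.
  by rewrite (dvdn_trans (dvdn_orbit _ _ _)) //= norm_joinEr // dvdn_cardMg.
have co_qX: coprime q #|X|.
  rewrite prime_coprime //; apply/negP=> q_dv_X.
  have : p * q %| #|X|.
    by rewrite Gauss_dvd ?p_dv_X // prime_coprime // dvdn_prime2 // ltn_eqF.
  have X_gt0: 0 < #|X| by apply/card_gt0P; exists Q; apply: orbit_refl.
  move/(dvdn_leq X_gt0); rewrite leqNgt (ltn_trans X_lt) //.
  by rewrite -mulnn ltn_pmul2l ?prime_gt0.
rewrite Gauss_dvdl in X_dv; last first.
  by have [k ->] := p_natP qY; rewrite coprime_sym coprimeXl.
have [k def_X] := p_natP (pnat_dvd X_dv (pHall_pgroup sylP)).
have lt_k2: k < 2 by rewrite -(ltn_exp2l _ _ (prime_gt1 p_pr)) -def_X.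
case: k def_X lt_k2 => [|[|//]] def_X _; last by rewrite def_X.
by rewrite def_X Euclid_dvd1 in p_dv_X.
Qed.

(** The case of a trivial [Y]. *)
Lemma Sylow_orbit (P Q : {group gT}) :
  p.-Sylow(G) P -> p.-Sylow(G) Q -> P :!=: Q -> #|orbit 'JG%act P Q| = p.
Proof.
move=> sylP sylQ neqPQ.
have [q ltpq q_pr] := prime_above p.
have := card_Sylow_orbit_join sylP sylQ neqPQ q_pr ltpq (pgroup1 _ q) (sub1G _).
by rewrite joingG1.
Qed.

Lemma Sylow_setI_norm (P Q : {group gT}) :
  p.-Sylow(G) P -> p.-Sylow(G) Q -> 'N_P(Q) = P :&: Q.
Proof.
move=> sylP sylQ; apply/setP=> x; rewrite !in_setI; apply: andb_id2l => Px.
have p_x: p.-elt x := mem_p_elt (pHall_pgroup sylP) Px.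
have Gx: x \in G := subsetP (pHall_sub sylP) x Px.
apply/idP/idP=> [nQx | /(subsetP (normG Q)) //].
have sylQN: p.-Sylow('N_G(Q)) Q by rewrite Sylow_subnorm.
have Nx: x \in 'N_G(Q) by rewrite in_setI Gx.
have nsQN: Q <| 'N_G(Q).
  by rewrite /normal subsetI (pHall_sub sylQ) normG subsetIr.
by rewrite (mem_normal_Hall sylQN nsQN Nx).
Qed.

Lemma Sylow_index_setI (P Q : {group gT}) :
  p.-Sylow(G) P -> p.-Sylow(G) Q -> P :!=: Q -> #|P : P :&: Q| = p.
Proof.
move=> sylP sylQ neqPQ; rewrite -(Sylow_orbit sylP sylQ neqPQ) card_orbit.
by rewrite astab1JG (Sylow_setI_norm sylP sylQ).
Qed.

(** The derived subgroup of [P] lies in [P :&: Q] for every conjugate [Q] of [P], as this has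
    prime index in [P]; so it lies in the core of [P]. *)
Lemma Sylow_abelian (P : {group gT}) : p.-Sylow(G) P -> abelian P.
Proof.
move=> sylP; rewrite (sameP derG1P trivgP).
rewrite -(gcore_simple (Sylow_proper sylP)).
apply/subsetP=> x P'x; apply/bigcapP=> g Gg.
have sylQ: p.-Sylow(G) (P :^ g)%G by rewrite pHallJ.
have [<- | neqPQ] := eqVneq (P : {set gT}) (P :^ g).
  exact: subsetP (der_sub 1 P) x P'x.
have iPQ := Sylow_index_setI sylP sylQ neqPQ.
have nsPQ: P :&: (P :^ g)%G <| P.
  have maxPQ: maximal (P :&: (P :^ g)%G) P.
    by rewrite p_index_maximal ?subsetIl ?iPQ.
  exact: p_maximal_normal (pHall_pgroup sylP) maxPQ.
have cyPQ: cyclic (P / (P :&: (P :^ g)%G)).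
  by rewrite prime_cyclic // card_quotient ?normal_norm //= iPQ.
have sP'PQ := der1_min (normal_norm nsPQ) (cyclic_abelian cyPQ).
by have /setIP[] := subsetP sP'PQ x P'x.
Qed.

(** The orbit of each Sylow subgroup under [P <*> Y] has [p < q] points, so [Y] fixes all of
    them and lies in the core of the normaliser. *)
Lemma norm_Sylow_larger (P Y : {group gT}) q :
    p.-Sylow(G) P -> prime q -> p < q -> q.-group Y -> Y \subset 'N_G(P) ->
  Y :=: 1.
Proof.
move=> sylP q_pr ltpq qY nPY; have [sYG nPY'] := subsetIP nPY.
apply/trivgP; rewrite -(gcore_simple (norm_Sylow_proper p_pr p_dv_G sylP)).
apply/bigcapsP=> g Gg; rewrite conjIg conjGid // -normJ subsetI sYG.
have sylQ: p.-Sylow(G) (P :^ g)%G by rewrite pHallJ.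
have [<- // | neqPQ] := eqVneq (P : {set gT}) (P :^ g).
have oX := card_Sylow_orbit_join sylP sylQ neqPQ q_pr ltpq qY nPY.
have := @pgroup_small_set_fix _ _ 'JG%act _ Y _ q_pr qY _ (eq_ind_r (ltn^~ q) ltpq oX).
rewrite (subset_trans (joing_subr P Y)) ?acts_orbit ?subsetT // => /(_ isT).
by move/subsetP/(_ _ (orbit_refl _ _ _)); rewrite afixJG.
Qed.

(** The normaliser of a Sylow subgroup is a [q']-group, and [p ^ 2 < q ^ 2]. *)
Lemma larger_prime_part q : prime q -> p < q -> q %| #|G| ->
  (#|G|`_q)%N = q /\ q %| #|'Syl_p(G)|.
Proof.
move=> q_pr ltpq q_dv_G; have [P sylP] := Sylow_exists p G.
have [Y sylY] := Sylow_exists q 'N_G(P).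
have oN: (#|'N_G(P)|`_q = 1)%N.
  rewrite -(card_Hall sylY); apply/eqP; rewrite -trivg_card1; apply/eqP.
  exact: norm_Sylow_larger sylP q_pr ltpq (pHall_pgroup sylY) (pHall_sub sylY).
have def_q: (#|G|`_q = #|'Syl_p(G)|`_q)%N.
  rewrite -(Lagrange (subsetIl G 'N(P))) partnM ?cardG_gt0 ?indexg_gt0 //.
  by rewrite oN mul1n (card_Syl sylP).
have n_gt0: 0 < #|'Syl_p(G)| by apply: ltnW (Syl_gt1 p_pr p_dv_G).
have q_dv: q %| (#|'Syl_p(G)|`_q)%N.
  by rewrite -def_q p_part dvdn_exp // logn_gt0 mem_primes q_pr cardG_gt0.
split; last exact: dvdn_trans q_dv (dvdn_part _ _).
have := dvdn_leq n_gt0 (dvdn_part q _); move: q_dv; rewrite def_q p_part.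
case: (logn q _) => [|[|k]]; rewrite ?expn0 ?expn1 //.
  by rewrite Euclid_dvd1.
move=> _ le_qk; have: p ^ 2 < q ^ k.+2.
  by rewrite (@leq_trans (q ^ 2)) ?ltn_sqr ?leq_pexp2l ?prime_gt0.
by rewrite ltnNge (leq_trans le_qk few).
Qed.

(** Both primes divide the number of Sylow [p]-subgroups, which is less than [q * r]. *)
Lemma larger_prime_unique q r : prime q -> prime r -> p < q -> p < r ->
  q %| #|G| -> r %| #|G| -> q = r.
Proof.
move=> q_pr r_pr ltpq ltpr q_dv r_dv; apply/eqP; apply: contraT => neq_qr.
have [_ q_dvn] := larger_prime_part q_pr ltpq q_dv.
have [_ r_dvn] := larger_prime_part r_pr ltpr r_dv.
have: q * r %| #|'Syl_p(G)|.
  by rewrite Gauss_dvd ?q_dvn // prime_coprime // dvdn_prime2.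
move/dvdn_leq => /(_ (ltnW (Syl_gt1 p_pr p_dv_G))); apply: contraLR => _.
by rewrite -ltnNge (leq_ltn_trans few) // -mulnn ltn_mul.
Qed.

(** Both [#|G : H|] and the number of Sylow subgroups of [H] are 1 modulo [p]. If neither is 1,
    they exceed [p] and their product exceeds [p ^ 2]. *)
Lemma norm_Sylow_maximal (P H : {group gT}) :
    p.-Sylow(G) P -> H \subset G -> 'N_G(P) \subset H -> ~~ (H \subset 'N(P)) ->
  H :=: G.
Proof.
move=> sylP sHG sNH not_nHP.
have sPN: P \subset 'N_G(P) by rewrite subsetI (pHall_sub sylP) normG.
have sylPH: p.-Sylow(H) P := pHall_subl (subset_trans sPN sNH) sHG sylP.
have defN: 'N_H(P) = 'N_G(P).
  by apply/eqP; rewrite eqEsubset setSI //= subsetI sNH subsetIr.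
have nH_gt1: 1 < #|'Syl_p(H)|.
  by rewrite (card_Syl sylPH) indexg_gt1 subsetI subxx.
have nH_mod := card_Syl_mod H p_pr; have nG_mod := card_Syl_mod G p_pr.
have def_n: #|'Syl_p(G)| = (#|G : H| * #|'Syl_p(H)|)%N.
  by rewrite (card_Syl sylP) (card_Syl sylPH) defN Lagrange_index.
have i_mod: #|G : H| %% p = 1%N.
  by rewrite -nG_mod def_n -modnMmr nH_mod muln1.
apply/eqP; rewrite eqEsubset sHG -indexg_eq1 eqn_leq indexg_gt0 andbT leqNgt.
apply/negP=> i_gt1.
have gt_p m: m %% p = 1%N -> 1 < m -> p < m.
  move=> m_mod m_gt1; rewrite ltnNge leq_eqVlt; apply/norP; split.
    by apply: contra_eqN m_mod => /eqP->; rewrite modnn.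
  by apply: contraTN m_gt1 => lt_mp; rewrite -m_mod modn_small // ltnn.
have := few; rewrite def_n leqNgt -mulnn ltn_mul //; exact: gt_p.
Qed.

(** With [D = P :&: Q], the stabiliser of [Q] in [P <*> O] is [D <*> O]. Hence [O] fixes
    [Q :^ x] if and only if [x] normalises [D <*> O], and the fixed points form an orbit of a
    subgroup between [D] and [P]. *)
Lemma card_orbit_fixed_points (P Q O : {group gT}) :
    p.-Sylow(G) P -> p.-Sylow(G) Q -> P :!=: Q -> O \subset 'N_G(P) -> O \subset 'N(Q) ->
  #|orbit 'JG%act P Q :&: 'Fix_('JG%act)(O)| \in pred2 1%N p.
Proof.
move=> sylP sylQ neqPQ nPO' nQO; set m := #|_|; have [sOG nPO] := subsetIP nPO'.
pose D := (P :&: Q)%G; pose F := 'N_P(D <*> O)%G.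
have nDO: O \subset 'N(D) by rewrite normsI.
have nDP: P \subset 'N(D).
  by rewrite sub_abelian_norm ?subsetIl ?(Sylow_abelian sylP).
have sDF: D \subset F.
  by rewrite subsetI subsetIl (subset_trans (joing_subl D O)) ?normG.
have sDQN: D <*> O \subset 'N(Q).
  by rewrite join_subG nQO (subset_trans (subsetIr P Q)) ?normG.
have defDO: 'N_(P <*> O)(Q) = D <*> O.
  rewrite /= norm_joinEr // norm_joinEr // setIC -group_modr // [_ :&: P]setIC.
  by rewrite (Sylow_setI_norm sylP sylQ).
have oX: orbit 'JG%act P Q :&: 'Fix_('JG%act)(O) = orbit 'JG%act F Q.
  apply/setP=> R; rewrite in_setI afixJG; apply/andP/orbitP.
    case=> /orbitP[x Px <- {R}] /= nQxO; exists x => //.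
    have Px1: x^-1 \in P by rewrite groupV.
    rewrite in_setI Px -groupV inE conjYg (normsP nDP) // join_subG joing_subl.
    have /= <- := defDO; rewrite subsetI !sub_conjgV -normJ nQxO andbT conjGid ?joing_subr //.
    exact: subsetP (joing_subl P O) x Px.
  case=> x /setIP[Px nDOx] <- {R}; split; first exact: mem_orbit.
  rewrite /= normJ (subset_trans (joing_subr D O)) //.
  by have /= <- := normP nDOx; rewrite conjSg.
have: m %| p.
  rewrite /m oX card_orbit astab1JG -(Sylow_index_setI sylP sylQ neqPQ).
  have -> : 'N_F(Q) = D.
    apply/eqP; rewrite eqEsubset subsetI sDF (subset_trans (joing_subl D O)) //.
    by rewrite -[D : {set gT}](Sylow_setI_norm sylP sylQ) setSI ?subsetIl.
  have sFP: F \subset P := subsetIl _ _.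
  by have /= <- := Lagrange_index sFP sDF; rewrite dvdn_mull.
by case/primeP: p_pr => _ dv_p /dv_p.
Qed.

(** Suppose that [O] moves [P]. The fixed points of [O] are then permuted by [P] without fixed
    point, so their number is 0 modulo [p]; apart from [P1] there are [-1] modulo [p] of them.
    They are spread over fewer than [p] orbits of [P1], each of which contains none, one or [p]
    of them, so every orbit contains exactly one. The orbit of [P1] through [P] is thus
    stable under [O]; but the orbit of [P] under [O] has 1 modulo [p] points and cannot have
    length 1. *)
Lemma p'group_fix_cent (P P1 O : {group gT}) :
    p.-Sylow(G) P -> p.-Sylow(G) P1 -> p^'.-group O -> O \subset 'N_G(P1) ->
    P \subset 'N(O) ->
  O \subset 'C(P).
Proof.
move=> sylP sylP1 p'O nP1O' nOP; have [sOG nP1O] := subsetIP nP1O'.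
have sPG := pHall_sub sylP.
(* If O normalises P, then the commutator of O and P lies in their trivial intersection. *)
suff nPO: O \subset 'N(P).
  rewrite -commg_subr in nPO; rewrite -commg_subl in nOP.
  apply/commG1P/trivgP; rewrite /= -(@coprime_TIg _ O P).
    by rewrite subsetI nOP.
  by rewrite coprime_sym (pnat_coprime (pHall_pgroup sylP)).
apply: contraT => not_nPO.
pose F := 'Fix_('Syl_p(G) | 'JG)(O); pose orb := orbit 'JG%act P1.
have p_dv_F: p %| #|F|.
  apply: dvdn_Syl_D1 sylP _ _.
    by rewrite actsI ?Syl_actsJ ?acts_fix_norm.
  apply/subsetP=> Q /setIP[sylQ fixQ]; rewrite in_setD1 sylQ andbT.
  by apply: contraNneq not_nPO => <-; rewrite -afixJG.
have FP1: P1 \in F by rewrite in_setI inE sylP1 afixJG.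
have neqP1P: P1 :!=: P by apply: contraNneq not_nPO => <-.
pose Om1 := 'Syl_p(G) :\ P1; pose T := orb @: Om1.
have nOm1: [acts P1, on Om1 | 'JG].
  by apply: Syl_acts_D1; rewrite subsetI (pHall_sub sylP1) normG.
have card_T X: X \in T -> #|X| = p.
  case/imsetP=> Q; rewrite !inE => /andP[neqQP1 sylQ] ->.
  by apply: Sylow_orbit => //; rewrite eq_sym.
have lt_T: #|T| < p.
  have := acts_sum_card_orbit nOm1; rewrite (eq_bigr _ card_T) sum_nat_const => oT.
  by have := card_Syl_D1 sylP1; rewrite -oT -mulnn ltn_pmul2r ?prime_gt0.
have sFSyl: F \subset 'Syl_p(G) by apply: subsetIl.
have sumF: ((\sum_(X in T) #|X :&: F|).+1 = #|F|)%N.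
  rewrite (cardsD1 P1 F) FP1 add1n; congr _.+1.
  have -> : F :\ P1 = [set Q in Om1 | Q \in F].
    apply/setP=> Q; rewrite [RHS]inE !in_setD1 -andbA; case: eqP => //= _.
    by rewrite andb_idl // => /(subsetP sFSyl); rewrite inE.
  rewrite -sum1_card (eq_bigl (fun Q => (Q \in Om1) && (Q \in F))) => [|Q]; last first.
    by rewrite inE.
  rewrite (set_partition_big_cond _ (orbit_partition nOm1)).
  apply: eq_bigr => X _; rewrite -sum1_card; apply: eq_bigl => Q.
  by rewrite in_setI.
have oXF X: X \in T -> (#|X :&: F| = (#|X :&: F| == 1) %[mod p])%N.
  case/imsetP=> R Om1R defX.
  have [-> | /set0Pn[Q /setIP[XQ FQ]]] := eqVneq (X :&: F) set0.
    by rewrite cards0 mod0n.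
  have /setIP[sylQ fixQ] := FQ; rewrite inE in sylQ.
  have sXOm1: X \subset Om1 by rewrite defX acts_sub_orbit.
  have neqP1Q: P1 :!=: Q by have := subsetP sXOm1 Q XQ; rewrite !inE eq_sym; case/andP.
  have{} defX: X = orb Q by rewrite defX; apply/esym/orbit_eqP; rewrite -/orb -defX.
  have -> : X :&: F = orb Q :&: 'Fix_('JG%act)(O).
    rewrite defX setIA; congr (_ :&: _); apply/setIidPl.
    by rewrite acts_sub_orbit ?Syl_actsJ ?inE ?(pHall_sub sylP1).
  rewrite afixJG in fixQ.
  have := card_orbit_fixed_points sylP1 sylQ neqP1Q nP1O' fixQ; rewrite inE.
  by case/orP=> /eqP->; rewrite ?eqxx // modnn gtn_eqF ?prime_gt1 // mod0n.
(* An orbit without fixed points would leave at most p - 2 orbits to provide -1 modulo p. *)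
have TP: orb P \in T by apply: imset_f; rewrite in_setD1 eq_sym neqP1P inE.
have /set0Pn[Q /setIP[PQ FQ]]: orb P :&: F != set0.
  apply/eqP=> PF0; have: p %| (\sum_(X in T) (#|X :&: F| == 1)%N).+1.
    rewrite -addn1 /dvdn -modnDml -modn_summ -(eq_bigr _ oXF) modn_summ modnDml.
    by rewrite addn1 sumF.
  move/(dvdn_leq (ltn0Sn _)); rewrite leqNgt => /negP[].
  apply: leq_ltn_trans lt_T; rewrite (bigD1 _ TP) /= PF0 cards0 add0n.
  rewrite (cardsD1 (orb P) T) TP add1n ltnS.
  have -> : #|T :\ orb P| = (\sum_(X in T | X != orb P) 1)%N.
    by rewrite -sum1_card; apply: eq_bigl => X; rewrite in_setD1 andbC.
  by apply: leq_sum => X _; apply: leq_b1.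
have sOP: orbit 'JG%act O P \subset orb P.
  have eqPQ: orb P = orb Q by apply/esym/orbit_eqP.
  have fixQ a: a \in O -> 'JG%act Q a = Q.
    by have /setIP[_ /afixP fixQ] := FQ => Oa; apply: fixQ.
  apply/subsetP=> _ /orbitP[a Oa <-].
  have: P \in orb Q by rewrite -eqPQ orbit_refl.
  rewrite eqPQ => /orbitP[x P1x <-]; rewrite actCJ fixQ // mem_orbit //.
  by rewrite memJ_norm ?(subsetP nP1O).
have oP: #|orbit 'JG%act O P| <= p by rewrite -(card_T _ TP) subset_leq_card.
have O_mod := card_orbit_normalised sylP sOG nOP.
have ltOp: #|orbit 'JG%act O P| < p.
  rewrite ltn_neqAle oP andbT; apply: contra_eqN O_mod => /eqP->.
  by rewrite modnn.
rewrite modn_small // in O_mod; case/negP: not_nPO; rewrite -afixJG.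
by apply/afixP=> a Oa; apply/set1P; rewrite -(card_orbit1 O_mod) mem_orbit.
Qed.

(** * Three prime divisors *)

Hypotheses (odd_p : odd p).
Hypothesis min_p : forall q, prime q -> odd q -> q %| #|G| -> p <= q.

(** By Burnside's theorem [#|G|] has three prime divisors, so at least one of them exceeds [p];
    and exactly one does, by [larger_prime_unique]. *)
Lemma order_three_primes :
  exists2 r, prime r & [/\ p < r, 2 %| #|G|, (#|G|`_r)%N = r,
    exists c, #|'Syl_p(G)| = (2 ^ c * r)%N &
    #|G| = (#|G|`_2 * (#|G|`_p * r))%N].
Proof.
have prG_gt2: 2 < size (primes #|G|).
  rewrite ltnNge; apply/negP=> /Burnside_p_a_q_b solG.
  by case/negP: ncG; apply/cyclic_abelian/prime_cyclic/simple_sol_prime.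
have [r [r_pr r_dv_G neq_r2 neq_rp]]:
  exists r, [/\ prime r, r %| #|G|, r != 2 & r != p].
  have /hasP[r]: has (fun r => (r != 2) && (r != p)) (primes #|G|).
    apply: contraLR prG_gt2 => /hasPn sub; rewrite -leqNgt.
    apply: (@uniq_leq_size _ _ [:: 2; p]) (primes_uniq _) _ => q /sub.
    by rewrite !inE -negb_or negbK.
  rewrite mem_primes => /and3P[r_pr _ r_dv] /andP[r2 rp].
  by exists r.
have gt_p q: prime q -> q %| #|G| -> q != 2 -> q != p -> p < q.
  move=> q_pr q_dv neq_q2 neq_qp; rewrite ltn_neqAle eq_sym neq_qp min_p //.
  by case: (even_prime q_pr) neq_q2 => // ->.
have ltpr := gt_p r r_pr r_dv_G neq_r2 neq_rp.
have [oGr r_dv_n] := larger_prime_part r_pr ltpr r_dv_G.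
have only q: prime q -> q %| #|G| -> q \in [:: 2; p; r].
  move=> q_pr q_dv; rewrite !inE; case: eqVneq => //= neq_q2.
  case: eqVneq => //= neq_qp; apply/eqP.
  by apply: larger_prime_unique => //; apply: gt_p.
exists r => //; split=> //.
- have sub: {subset primes #|G| <= [:: 2; p; r]}.
    by move=> q; rewrite mem_primes => /and3P[q_pr _]; apply: only.
  have [_ /(_ 2)] := uniq_min_size (primes_uniq _) sub prG_gt2.
  by rewrite mem_primes !inE eqxx cardG_gt0 /= => ->.
- have n_gt0: 0 < #|'Syl_p(G)| by apply: ltnW (Syl_gt1 p_pr p_dv_G).
  have def_n := divnK r_dv_n; set m := (_ %/ r)%N in def_n.
  have m_gt0: 0 < m by rewrite -def_n muln_gt0 in n_gt0; case/andP: n_gt0.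
  suff /p_natP[c def_m]: 2.-nat m by exists c; rewrite -def_m def_n.
  apply/pnatP=> // q q_pr q_dv_m.
  have q_dv_n: q %| #|'Syl_p(G)| by rewrite -def_n dvdn_mulr.
  have /only: q %| #|G| := dvdn_trans q_dv_n (card_Syl_dvd p G).
  rewrite !inE => /(_ q_pr)/or3P[|/eqP eq_qp|/eqP eq_qr] //.
    have := card_Syl_mod G p_pr; rewrite eq_qp /dvdn in q_dv_n.
    by rewrite (eqP q_dv_n).
  have: r ^ 2 %| #|G|.
    rewrite (dvdn_trans _ (card_Syl_dvd p G)) // -def_n dvdn_mul //.
    by rewrite -eq_qr.
  rewrite pfactor_dvdn // => /(leq_pexp2l (prime_gt0 r_pr)).
  by rewrite -p_part oGr leqNgt -{1}[r]expn1 ltn_exp2l ?prime_gt1.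
rewrite -{1}(partnC 2 (cardG_gt0 G)); congr (_ * _)%N.
rewrite -(partnC p (part_gt0 2^' #|G|)).
have neq_p2: p != 2 by apply: contraTneq odd_p => ->.
congr (_ * _)%N.
  by rewrite partn_part // => q; rewrite !inE => /eqP->.
rewrite -[RHS]oGr -partnI; apply: eq_in_partn => q.
rewrite mem_primes => /and3P[q_pr _ q_dv]; have:= only q q_pr q_dv.
rewrite !inE; case: (eqVneq q 2) => [-> _ | _ /=].
  by rewrite [RHS]eq_sym (negPf neq_r2).
by case: (eqVneq q p) => [-> _ | _ /=]; rewrite ?[p == r]eq_sym ?(negPf neq_rp) // => ->.
Qed.

Section TwoOddPrimes.

Variable r : nat.
Hypotheses (r_pr : prime r) (ltpr : p < r) (even_G : 2 %| #|G|).
Hypotheses (oGr : (#|G|`_r)%N = r) (oG : #|G| = (#|G|`_2 * (#|G|`_p * r))%N).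
Hypothesis solG : forall H : {group gT}, H \proper G -> solvable H.

Lemma prime_dvd_G q : prime q -> q %| #|G| -> q \in [:: 2; p; r].
Proof.
move=> q_pr; rewrite oG !inE !Euclid_dvdM // (dvdn_prime2 q_pr r_pr).
have part (s : nat) : q %| (#|G|`_s)%N -> q == s.
  by move=> q_dv; have /pnatP/(_ q q_pr q_dv) := part_pnat s #|G|; apply.
by case/or3P=> [/part->|/part->|->]; rewrite ?orbT.
Qed.

Lemma r_group_norm_Sylow (P R : {group gT}) :
  p.-Sylow(G) P -> r.-group R -> R \subset 'N_G(P) -> R :=: 1.
Proof. by move=> sylP; apply: norm_Sylow_larger sylP r_pr ltpr. Qed.

Lemma neq_p2 : p != 2.
Proof. by apply: contraTneq odd_p => ->. Qed.

Lemma odd_r : odd r.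
Proof. by case: (even_prime r_pr) => // r2; have := prime_gt1 p_pr; lia. Qed.

Lemma neq_r2 : r != 2.
Proof. by apply: contraTneq odd_r => ->. Qed.

Lemma p'r'_2group (H : {group gT}) : ~~ (r %| #|H|) -> H \subset G ->
  p^'.-group H -> 2.-group H.
Proof.
move=> r'H sHG p'H; apply/pgroupP=> q q_pr q_dv.
have := prime_dvd_G q_pr (dvdn_trans q_dv (cardSg sHG)).
rewrite !inE => /or3P[// | /eqP eq_qp | /eqP eq_qr].
  by move: p'H; rewrite /pgroup p'natE // -eq_qp q_dv.
by rewrite -eq_qr q_dv in r'H.
Qed.

(** * The case of r Sylow p-subgroups *)

Section PrimeDegree.

Hypothesis n_r : #|'Syl_p(G)| = r.

(** An element of order [r] permutes the [r] Sylow subgroups without fixed points. If it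
    commutes with [x], it permutes the fixed points of [x], which are therefore all the Sylow
    subgroups, and [x] lies in the core of the normaliser of [P]. *)
Lemma r'_cent1_prime_degree (P : {group gT}) x :
  p.-Sylow(G) P -> x \in P -> x != 1 -> ~~ (r %| #|'C_G[x]|).
Proof.
move=> sylP Px ntx; apply/negP=> /(Cauchy r_pr)[y].
rewrite in_setI => /andP[Gy /cent1P cxy] oy.
pose F := 'Fix_('Syl_p(G) | 'JG)[x].
have rY: r.-group <[y]> by rewrite /pgroup -orderE oy pnat_id.
have sYG: <[y]> \subset G by rewrite cycle_subG.
have r_dv_F: r %| #|F|.
  have actF: [acts <[y]>, on F | 'JG].
    rewrite actsI ?Syl_actsJ // -afix_cycle acts_fix_norm //.
    by rewrite cents_norm // cent_cycle cycle_subG; apply/cent1P.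
  rewrite /dvdn (pgroup_fix_mod rY actF).
  suff -> : 'Fix_(F | 'JG)(<[y]>) = set0 by rewrite cards0 mod0n.
  apply/setP=> Q; rewrite in_setI in_set0 afixJG; apply/andP=> -[/setIP[+ _] nQY].
  rewrite inE => sylQ; have := r_group_norm_Sylow sylQ rY; rewrite subsetI sYG nQY.
  by move/(_ isT)/eqP; rewrite cycle_eq1 -order_eq1 oy gtn_eqF ?prime_gt1.
have FP: P \in F.
  by rewrite in_setI inE sylP -afix_cycle afixJG cycle_subG (subsetP (normG P)).
have sFS: F \subset 'Syl_p(G) by apply: subsetIl.
have eqF: F = 'Syl_p(G).
  apply/eqP; rewrite eqEcard sFS n_r dvdn_leq //.
  by apply/card_gt0P; exists P.
case/negP: ntx; rewrite -in_set1 -[[set 1]](gcore_simple (norm_Sylow_proper p_pr p_dv_G sylP)).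
apply/bigcapP=> g Gg; have: (P :^ g)%G \in F by rewrite eqF inE pHallJ.
case/setIP=> _; rewrite -afix_cycle afixJG cycle_subG => nPgx.
rewrite conjIg conjGid // in_setI (subsetP (pHall_sub sylP)) //.
by rewrite -normJ.
Qed.

(** Otherwise [P] shares some [x] with another Sylow subgroup [Q], and [P] and [Q] lie in the
    solvable group [C = 'C_G[x]]. The [p']-part [O] of its Fitting subgroup is a 2-group; it
    fixes a Sylow subgroup because their number is odd, so [P] centralises it by
    [p'group_fix_cent]. Then [P] centralises the Fitting subgroup, hence lies in it and in
    [Q]. *)
Lemma card_Sylow_prime_degree (P : {group gT}) : p.-Sylow(G) P -> #|P| = p.
Proof.
move=> sylP; have sPG := pHall_sub sylP.
have: 0 < #|'Syl_p(G) :\ P|.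
  by have := cardsD1 P 'Syl_p(G); rewrite inE sylP; have := (Syl_gt1 p_pr p_dv_G); lia.
case/card_gt0P=> Q; rewrite !inE eq_sym => /andP[neqPQ sylQ].
have iPQ := Sylow_index_setI sylP sylQ neqPQ.
have [D1 | /trivgPn[x /setIP[Px Qx] ntx]] := eqVneq (P :&: Q) 1.
  by rewrite -iPQ D1 indexg1.
pose C := ('C_G[x])%G; have Gx: x \in G := subsetP sPG x Px.
have prC: C \proper G by apply: cent1_proper_simple.
have sCG := proper_sub prC; have cF := cent_sub_Fitting (solG prC).
have sSC (R : {group gT}) : p.-Sylow(G) R -> x \in R -> R \subset C.
  move=> sylR Rx; rewrite subsetI (pHall_sub sylR) sub_cent1.
  exact: subsetP (Sylow_abelian sylR) x Rx.
have sylPC: p.-Sylow(C) P := pHall_subl (sSC P sylP Px) sCG sylP.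
have sylQC: p.-Sylow(C) Q := pHall_subl (sSC Q sylQ Qx) sCG sylQ.
pose O := 'O_p^'('F(C))%G.
have sOC: O \subset C by rewrite gFsub_trans ?Fitting_sub.
have p'O: p^'.-group O := pcore_pgroup _ _.
have pO: 2.-group O.
  apply: p'r'_2group (subset_trans sOC sCG) p'O.
  apply: contra (r'_cent1_prime_degree sylP Px ntx) => r_dv.
  exact: dvdn_trans r_dv (cardSg sOC).
have sOG := subset_trans sOC sCG.
have /set0Pn[P1 /setIP[sylP1 nP1O]]: 'Fix_('Syl_p(G) | 'JG)(O) != set0.
  rewrite -cards_eq0; apply/eqP=> F0.
  have := pgroup_fix_mod pO (Syl_actsJ p sOG).
  by rewrite F0 n_r !modn2 odd_r.
rewrite inE in sylP1; rewrite afixJG in nP1O.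
have cOP: O \subset 'C(P).
  apply: p'group_fix_cent sylP sylP1 p'O _ _; first by rewrite subsetI sOG.
  rewrite (subset_trans (pHall_sub sylPC)) // gFnorm_trans //.
  exact: normal_norm (Fitting_normal C).
have cPO: P \subset 'C(O) by rewrite centsC.
have cPF: P \subset 'C('F(C)).
  rewrite -(dprodW (nilpotent_pcoreC p (Fitting_nil C))) centM subsetI.
  rewrite cPO andbT /= p_core_Fitting (subset_trans (Sylow_abelian sylP)) // centS //.
  exact: pcore_sub_Hall sylPC.
have sPF: P \subset 'F(C).
  by apply: subset_trans cF; rewrite subsetI (pHall_sub sylPC).
have sPQ: P \subset Q.
  have sylPF := pHall_subl sPF (Fitting_sub C) sylPC.
  have /= -> := eq_Hall_pcore (nilpotent_pcore_Hall p (Fitting_nil C)) sylPF.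
  by rewrite p_core_Fitting (pcore_sub_Hall sylQC).
case/eqP: neqPQ; apply/val_inj/eqP; rewrite /= eqEcard sPQ.
by rewrite (card_Hall sylP) (card_Hall sylQ) leqnn.
Qed.

(** A Sylow 2-subgroup [S] of [G] normalises [P]. If it did not act faithfully, some central
    element of [S] would commute with [P] and have a class of size 1 or [r]. So [S] is cyclic,
    and for each nontrivial [s] in [S] the size of its class is [p * r], that is, the centraliser
    is [S]. Consequently [S] is a trivial intersection subgroup equal to its normaliser, and
    the conjugates of the nontrivial elements of [S], of [P] and of a group of order [r] are too
    many. *)
Lemma not_prime_degree : False.
Proof.
have neq_2p: 2 != p by rewrite eq_sym neq_p2.
have neq_2r: 2 != r by apply: contraTneq odd_r => <-.
have [P sylP] := Sylow_exists p G; have oP := card_Sylow_prime_degree sylP.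
have sPG := pHall_sub sylP; have sPN: P \subset 'N_G(P).
  by rewrite subsetI sPG normG.
have [S sylSN] := Sylow_exists 2 'N_G(P).
have [sSN pS _] := and3P sylSN; have [sSG nPS] := subsetIP sSN.
have iN: #|G : 'N_G(P)| = r by rewrite -(card_Syl sylP).
have oN := Lagrange (subsetIl G 'N(P)); rewrite iN in oN.
have oS: #|S| = (#|G|`_2)%N.
  rewrite (card_Hall sylSN) -oN partnM ?cardG_gt0 ?prime_gt0 //.
  by rewrite (@part_p'nat 2 r) ?muln1 // p'natE // dvdn_prime2.
have oG' : #|G| = (#|S| * (p * r))%N by rewrite oG -oS -(card_Hall sylP) oP.
have iS: #|G : S| = (p * r)%N by rewrite -divgS // oG' mulKn.
have ntS: S :!=: 1.
  by rewrite trivg_card1 oS p_part_eq1 mem_primes even_G cardG_gt0.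
have regS: 'C_S(P) = 1.
  apply/eqP; apply: contraT => ntV.
  have nsV: 'C_S(P) <| S.
    by rewrite /normal subsetIl normsI ?normG ?norms_cent.
  have := meet_center_nil (pgroup_nil pS) nsV ntV.
  case/trivgPn=> z /setIP[/setIP[Sz cPz] /setIP[_ cSz]] ntz.
  have Gz := subsetP sSG z Sz.
  case/negP: (cent1_prime_index_simple Gz ntz r_pr).
  rewrite oG' mulnA dvdn_pmul2r ?prime_gt0 //.
  have sSC: S \subset 'C_G[z] by rewrite subsetI sSG sub_cent1.
  have sPC: P \subset 'C_G[z] by rewrite subsetI sPG sub_cent1.
  rewrite Gauss_dvd ?cardSg // -?oP ?cardSg //.
  by rewrite (pnat_coprime pS) // oP p'natE // dvdn_prime2 // eq_sym neq_p2.
have cyS: cyclic S by apply: (cyclic_faithful_prime _ nPS regS); rewrite oP.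
have cS z : z \in S -> z != 1 -> 'C_G[z] = S.
  move=> Sz ntz; have Gz := subsetP sSG z Sz.
  apply: (cent1_index_simple Gz ntz _ p_pr r_pr iS).
  by rewrite subsetI sSG sub_cent1 (subsetP (cyclic_abelian cyS)).
have NS: 'N_G(S) \subset S.
  have [_ even_S _] := pgroup_pdiv pS ntS.
  have [z Sz oz] := Cauchy (isT : prime 2) even_S.
  have ntz: z != 1 by rewrite -order_eq1 oz.
  rewrite -{2}(cS z Sz ntz); apply/subsetP=> y /setIP[Gy nSy].
  rewrite in_setI Gy cent1C; apply/cent1P/commgP/conjg_fixP.
  have : z ^ y \in <[z]>.
    suff -> : <[z]> = <[z ^ y]> by apply: cycle_id.
    apply/eqP; rewrite (eq_subG_cyclic cyS) ?cycle_subG ?memJ_norm //.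
    by rewrite -!orderE orderJ.
  by rewrite cycle2g // !inE conjg_eq1 (negPf ntz) => /eqP.
have tiS: normedTI S^# G S.
  apply/normedTI_P; split=> [||g Gg].
  - by rewrite setD_eq0 subG1.
  - by rewrite subsetI sSG normD1 normG.
  case/pred0Pn=> x /andP[/setD1P[ntx Sx]]; rewrite conjD1g => /setD1P[_ Sgx].
  apply: (subsetP NS); rewrite in_setI Gg inE -{2}(cS x Sx ntx).
  rewrite subsetI -{1}(conjGid Gg) conjSg sSG sub_cent1.
  have cSg: abelian (S :^ g) by rewrite abelianJ cyclic_abelian.
  exact: subsetP cSg x Sgx.
have [R sylR] := Sylow_exists r G.
have oR: #|R| = r by rewrite (card_Hall sylR).
have tiP: normedTI P^# G 'N_G(P) by rewrite normedTI_prime ?oP.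
have tiR: normedTI R^# G 'N_G(R) by rewrite normedTI_prime ?oR ?(pHall_sub sylR).
have cardD1 (H : {group gT}) : #|H^#| = #|H|.-1 by rewrite (cardsD1 1 H) group1.
have := card_support_normedTI tiS; rewrite cardD1 iS => cardS.
have := card_support_normedTI tiP; rewrite cardD1 iN oP => cardP.
have := card_support_normedTI tiR; rewrite cardD1 oR -(card_Syl sylR) => cardR.
have nR_gt1: 1 < #|'Syl_r(G)|.
  by apply: Syl_gt1 r_pr _; rewrite oG !dvdn_mull.
set A := class_support S^# G in cardS; set B := class_support P^# G in cardP.
set C := class_support R^# G in cardR.
have AB : A :&: B = set0 := class_support_TI G (isT : prime 2) p_pr neq_2p pS (pHall_pgroup sylP).
have AC : A :&: C = set0 := class_support_TI G (isT : prime 2) r_pr neq_2r pS (pHall_pgroup sylR).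
have BC : B :&: C = set0.
  apply: (class_support_TI G) p_pr r_pr _ (pHall_pgroup sylP) (pHall_pgroup sylR).
  by rewrite ltn_eqF.
have sABC: A :|: B :|: C \subset G^#.
  have sub (q : nat) (H : {group gT}) : q.-group H -> H \subset G ->
      class_support H^# G \subset G^#.
    move=> qH sHG; apply/subsetP=> x Hx; rewrite in_setD1.
    have /andP[_ ->] := class_support_elt qH Hx.
    exact: subsetP (class_support_subG (subset_trans (subD1set H 1) sHG)) x Hx.
  have [[sRG rR _] [_ pP _]] := (and3P sylR, and3P sylP).
  by rewrite !subUset (sub 2 S) // (sub p P) // (sub r R).
have := subset_leq_card sABC; rewrite cardsU setIUl AC BC setU0 cards0 subn0.
rewrite cardsU AB cards0 subn0 cardS cardP cardR cardD1 oG'.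
apply/negP; rewrite -ltnNge.
by apply: three_supports_ineq nR_gt1; rewrite ?prime_gt1.
Qed.

End PrimeDegree.

Lemma r'_norm_Sylow (P : {group gT}) : p.-Sylow(G) P -> ~~ (r %| #|'N_G(P)|).
Proof.
move=> sylP; apply/negP=> /(Cauchy r_pr)[y Ny oy].
have := @r_group_norm_Sylow P <[y]> sylP; rewrite /pgroup -orderE oy pnat_id //.
rewrite cycle_subG Ny => /(_ isT isT)/eqP.
by rewrite cycle_eq1 -order_eq1 oy gtn_eqF ?prime_gt1.
Qed.

Lemma norm_Sylow_factor (P U : {group gT}) :
  p.-Sylow(G) P -> 2.-Sylow('N_G(P)) U -> 'N_G(P) = P * U.
Proof.
move=> sylP sylU; have sPN: P \subset 'N_G(P).
  by rewrite subsetI (pHall_sub sylP) normG.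
have sylPN := pHall_subl sPN (subsetIl _ _) sylP.
apply/esym/(normal_Sylow_factor p_pr neq_p2 _ sylPN sylU) => s s_pr s_dv.
have := prime_dvd_G s_pr (dvdn_trans s_dv (cardSg (subsetIl _ _))).
rewrite !inE => /or3P[-> | -> | /eqP eq_sr]; rewrite ?orbT //.
by have := r'_norm_Sylow sylP; rewrite -eq_sr s_dv.
Qed.

(** * An even number of Sylow p-subgroups *)

Section EvenDegree.

Variable c : nat.
Hypotheses (c_gt0 : 0 < c) (def_n : #|'Syl_p(G)| = (2 ^ c * r)%N).

Lemma two_c_lt : 2 ^ c < p.
Proof.
by have := few; rewrite def_n -mulnn; apply: contraTltn => ?; rewrite -ltnNge; nia.
Qed.

(** The number of Sylow subgroups other than [P] is odd, because [c] is positive. *)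
Lemma Sylow2_fix_other (P U : {group gT}) :
    p.-Sylow(G) P -> 2.-group U -> U \subset 'N_G(P) ->
  exists Q : {group gT}, [/\ p.-Sylow(G) Q, P :!=: Q & U \subset 'N(Q)].
Proof.
move=> sylP pU nPU; have [sUG _] := subsetIP nPU.
have actU: [acts U, on 'Syl_p(G) :\ P | 'JG] by apply: Syl_acts_D1.
have := pgroup_fix_mod pU actU; rewrite !modn2.
have -> : odd #|'Syl_p(G) :\ P|.
  have := cardsD1 P 'Syl_p(G); rewrite inE sylP def_n => /(congr1 odd).
  by rewrite oddD oddM oddX eqn0Ngt c_gt0 /=; case: (odd _).
case: (set_0Vmem 'Fix_('Syl_p(G) :\ P | 'JG)(U)) => [-> | [Q]].
  by rewrite cards0.
rewrite in_setI afixJG !inE => /andP[/andP[neqQP sylQ] nQU] _.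
by exists Q; rewrite eq_sym.
Qed.

(** The normaliser of [X] contains [P * U], the maximal subgroup ['N_G(P)], and also [Q], so it
    is [G]. *)
Lemma norm_two_Sylow (X P Q U : {group gT}) :
    p.-Sylow(G) P -> p.-Sylow(G) Q -> P :!=: Q -> 2.-Sylow('N_G(P)) U ->
    X \proper G -> P \subset 'N(X) -> Q \subset 'N(X) -> U \subset 'N(X) ->
  X :=: 1.
Proof.
move=> sylP sylQ neqPQ sylU prX nXP nXQ nXU; apply/eqP; apply: contraT => ntX.
have sPG := pHall_sub sylP; have sQG := pHall_sub sylQ.
have sUG: U \subset G := subset_trans (pHall_sub sylU) (subsetIl _ _).
have sNX: 'N_G(P) \subset 'N_G(X).
  by rewrite (norm_Sylow_factor sylP sylU) mul_subG // subsetI ?sPG ?sUG.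
have not_nXP: ~~ ('N_G(X) \subset 'N(P)).
  apply: contra neqPQ => nPX; apply/eqP/esym/(Syl_normP sylQ sylP).
  by apply: subset_trans nPX; rewrite subsetI sQG.
have := norm_eq_simple ntX prX.
by rewrite (norm_Sylow_maximal sylP (subsetIl _ _) sNX not_nXP) properxx.
Qed.

(** Apply [norm_two_Sylow] to [P :&: Q], where [Q] is a second point fixed by [U]. *)
Lemma card_p_Sylow (P : {group gT}) : p.-Sylow(G) P -> #|P| = p.
Proof.
move=> sylP; have [U sylU] := Sylow_exists 2 'N_G(P).
have [sUN pU _] := and3P sylU; have [sUG nPU] := subsetIP sUN.
have [Q [sylQ neqPQ nQU]] := Sylow2_fix_other sylP pU sUN.
rewrite -(Sylow_index_setI sylP sylQ neqPQ).
rewrite (@norm_two_Sylow (P :&: Q)%G P Q U) ?indexg1 //.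
- exact: sub_proper_trans (subsetIl P Q) (Sylow_proper sylP).
- by rewrite sub_abelian_norm ?subsetIl ?(Sylow_abelian sylP).
- by rewrite sub_abelian_norm ?subsetIr ?(Sylow_abelian sylQ).
by rewrite normsI.
Qed.

Lemma card_r_Sylow (R : {group gT}) : r.-Sylow(G) R -> #|R| = r.
Proof. by move/card_Hall->. Qed.

(** Otherwise the orbit of [P] under [R] has [r] points and [r] is 1 modulo [p]. Then so is
    [2 ^ c], which is less than [p]: hence [c = 0]. *)
Lemma not_norm_r_Sylow (P R : {group gT}) :
  p.-Sylow(G) P -> r.-Sylow(G) R -> ~~ (P \subset 'N(R)).
Proof.
move=> sylP sylR; apply/negP=> nRP; have [sRG rR _] := and3P sylR.
have sPG := pHall_sub sylP.
have oO: #|orbit 'JG%act R P| = r.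
  rewrite card_orbit astab1JG -(card_r_Sylow sylR).
  rewrite (r_group_norm_Sylow (R := 'N_R(P)%G) sylP) ?indexg1 ?setSI //.
  exact: pgroupS (subsetIl _ _) rR.
have r_mod: r %% p = 1%N by rewrite -oO (card_orbit_normalised sylP sRG nRP).
have := card_Syl_mod G p_pr; rewrite def_n -modnMmr r_mod muln1.
rewrite modn_small ?two_c_lt // => /eqP; rewrite -(expn0 2) eqn_exp2l //.
by rewrite eqn0Ngt c_gt0.
Qed.

Lemma card_G : #|G| = (#|G|`_2 * (p * r))%N.
Proof.
have [P sylP] := Sylow_exists p G.
by rewrite {1}oG -(card_Hall sylP) (card_p_Sylow sylP).
Qed.

Lemma card_G_p : (#|G|`_p)%N = p.
Proof. by have [P sylP] := Sylow_exists p G; rewrite -(card_Hall sylP) card_p_Sylow. Qed.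

(** If [p] and [r] both divided [#|H|], a Hall [2']-subgroup of [H] would have order [p * r],
    hence a normal Sylow [r]-subgroup as [p < r]; but no Sylow [p]-subgroup normalises it. *)
Lemma no_pr_subgroup (H : {group gT}) :
  H \proper G -> p %| #|H| -> ~~ (r %| #|H|).
Proof.
move=> prH p_dv_H; apply/negP=> r_dv_H; have sHG := proper_sub prH.
have [K hallK] := Hall_exists 2^' (solG prH).
have [sKH p2K _] := and3P hallK; have sKG := subset_trans sKH sHG.
have [P sylPK] := Sylow_exists p K; have [R sylRK] := Sylow_exists r K.
have sylP : p.-Sylow(G) P.
  apply: prime_Sylow_sub p_pr card_G_p sHG p_dv_H _.
  by apply: subHall_Sylow hallK _ sylPK; rewrite !inE neq_p2.
have sylR : r.-Sylow(G) R.
  apply: prime_Sylow_sub r_pr oGr sHG r_dv_H _.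
  by apply: subHall_Sylow hallK _ sylRK; rewrite !inE neq_r2.
have nsRK: R <| K.
  have /normal_sylowP[R1 sylR1 nsR1] : #|'Syl_r(K)| == 1%N.
    rewrite -(card_Syl_mod K r_pr) modn_small //.
    apply: leq_ltn_trans ltpr; apply: dvdn_leq (prime_gt0 p_pr) _.
    have m_dv_K := card_Syl_dvd r K.
    have co_2: coprime #|'Syl_r(K)| #|G|`_2.
      by rewrite coprime_sym (pnat_coprime (part_pnat 2 _)) // (pnat_dvd m_dv_K).
    have co_r: coprime #|'Syl_r(K)| r.
      by rewrite -coprime_modl card_Syl_mod // coprime1n.
    have := dvdn_trans m_dv_K (cardSg sKG).
    by rewrite card_G Gauss_dvdr // Gauss_dvdl.
  have [x Kx ->] := Sylow_trans sylR1 sylRK.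
  by have /normsP-> := normal_norm nsR1.
have := not_norm_r_Sylow sylP sylR.
by rewrite (subset_trans (pHall_sub sylPK)) ?(normal_norm nsRK).
Qed.

(** The size of the class of [z] divides [p * r], and Burnside's theorem leaves no smaller
    value. *)
Lemma cent1_center_Sylow2 (S : {group gT}) z :
  2.-Sylow(G) S -> z \in 'Z(S) -> z != 1 -> 'C_G[z] = S.
Proof.
move=> sylS /setIP[Sz cSz] ntz; have [sSG _ _] := and3P sylS.
have Gz := subsetP sSG z Sz.
apply: (cent1_index_simple Gz ntz _ p_pr r_pr).
  by rewrite subsetI sSG sub_cent1.
by rewrite -divgS // {1}card_G (card_Hall sylS) mulKn // part_gt0.
Qed.

Lemma cent_two_Sylow (P Q U : {group gT}) :
    p.-Sylow(G) P -> p.-Sylow(G) Q -> P :!=: Q -> 2.-Sylow('N_G(P)) U ->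
    U \subset 'N(Q) -> 'C_('C_U(P))(Q) = 1.
Proof.
move=> sylP sylQ neqPQ sylU nQU; have [sUN pU _] := and3P sylU.
have [sUG nPU] := subsetIP sUN.
apply: (norm_two_Sylow (X := 'C_('C_U(P))(Q)%G) sylP sylQ neqPQ sylU).
- apply: sub_proper_trans (norm_Sylow_proper p_pr p_dv_G sylP).
  by rewrite (subset_trans _ sUN) //= -setIA subsetIl.
- by rewrite cents_norm // centsC /= -setIA subIset // subIset ?subxx // orbT.
- by rewrite cents_norm // centsC /= subsetIr.
by rewrite /= !normsI ?normG ?norms_cent.
Qed.

(** [U] fixes a second Sylow subgroup [Q], and by [norm_two_Sylow] the elements of [U]
    centralising [P] act faithfully on [Q], which has prime order. *)
Lemma cyclic_cent_Sylow2 (P U : {group gT}) :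
  p.-Sylow(G) P -> 2.-Sylow('N_G(P)) U -> cyclic 'C_U(P).
Proof.
move=> sylP sylU; have [sUN pU _] := and3P sylU.
have [Q [sylQ neqPQ nQU]] := Sylow2_fix_other sylP pU sUN.
apply: (cyclic_faithful_prime (P := Q)); first by rewrite (card_p_Sylow sylQ).
  by rewrite subIset ?nQU.
exact: cent_two_Sylow sylP sylQ neqPQ sylU nQU.
Qed.

(** As the only involution of a cyclic normal subgroup of [U], [e] is central in [U]; so its
    centraliser contains the maximal subgroup ['N_G(P)]. *)
Lemma cent1_involution (P : {group gT}) e :
  p.-Sylow(G) P -> e \in 'C_G(P) -> #[e] = 2 -> 'C_G[e] = 'N_G(P).
Proof.
move=> sylP /setIP[Ge cPe] oe; have nPe := subsetP (cent_sub P) e cPe.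
have nte: e != 1 by rewrite -order_eq1 oe.
have [U sylU sEU]: {U : {group gT} | 2.-Sylow('N_G(P)) U & <[e]> \subset U}.
  apply: Sylow_superset; first by rewrite cycle_subG in_setI Ge.
  by rewrite /pgroup -orderE oe.
rewrite cycle_subG in sEU.
have [sUN pU _] := and3P sylU; have [sUG nPU] := subsetIP sUN.
have cyV := cyclic_cent_Sylow2 sylP sylU.
have Ve: e \in 'C_U(P) by rewrite in_setI sEU.
have sUCe: U \subset 'C_G[e].
  apply/subsetP=> u Uu; rewrite in_setI (subsetP sUG) // cent1C.
  apply/cent1P/commgP/conjg_fixP.
  have nVu: u \in 'N('C_U(P)).
    by apply: subsetP u Uu; rewrite normsI ?normG ?norms_cent.
  have : e ^ u \in <[e]>.
    suff -> : <[e]> = <[e ^ u]> by apply: cycle_id.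
    apply/eqP; rewrite (eq_subG_cyclic cyV) ?cycle_subG ?memJ_norm //.
    by rewrite -!orderE orderJ.
  by rewrite cycle2g // !inE conjg_eq1 (negPf nte) => /eqP.
have sNC: 'N_G(P) \subset 'C_G[e].
  rewrite (norm_Sylow_factor sylP sylU) mul_subG //.
  by rewrite subsetI (pHall_sub sylP) sub_cent1.
have prC := cent1_proper_simple Ge nte.
apply/eqP; rewrite eqEsubset sNC subsetI subsetIl andbT.
apply: contraLR prC => /(norm_Sylow_maximal sylP (subsetIl _ _) sNC) /= ->.
by rewrite properxx.
Qed.

Lemma abelem_faithful_le2 (P E : {group gT}) :
    p.-Sylow(G) P -> 2.-abelem E -> E \subset 'N(P) -> 'C_E(P) = 1 -> #|E| <= 2.
Proof.
move=> sylP abE nPE regE.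
apply: cyclic_abelem_leq abE _ => //.
by apply: cyclic_faithful_prime nPE regE; rewrite (card_p_Sylow sylP).
Qed.

(** The elements of [E] centralising [P] form a cyclic group, and a complement to them acts
    faithfully on [P], so it is cyclic too. *)
Lemma abelem_norm_le4 (P E : {group gT}) :
    p.-Sylow(G) P -> 2.-abelem E -> E \subset 'N_G(P) -> #|E| <= 4.
Proof.
move=> sylP abE sEN; have [sEG nPE] := subsetIP sEN.
have [U sylU sEU] := Sylow_superset sEN (abelem_pgroup abE).
have cyC: cyclic 'C_E(P) := cyclicS (setSI _ sEU) (cyclic_cent_Sylow2 sylP sylU).
have abC: 2.-abelem 'C_E(P) := abelemS (subsetIl _ _) abE.
have /splitsP[D /complP[tiCD defE]] := abelem_splits abE (subsetIl E 'C(P)).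
have sDE: D \subset E by rewrite -defE mulG_subr.
rewrite -defE TI_cardMg // (@leq_mul _ _ 2 2) //.
  exact: (@cyclic_abelem_leq _ 'C_E(P)%G).
apply: abelem_faithful_le2 sylP (abelemS sDE abE) (subset_trans sDE nPE) _.
by apply/trivgP; rewrite -tiCD subsetI subsetIl andbT setSI.
Qed.

Lemma p_gt3 : 3 < p.
Proof.
rewrite ltnNge; apply/negP=> le_p3; have eq_p3: p = 3.
  by have := prime_gt1 p_pr; have := neq_p2; clear -le_p3; lia.
have r_ge5: 4 < r by have := odd_r; have := ltpr; rewrite eq_p3; case: (r) => [|[|[|[|[]]]]].
have := few; rewrite def_n eq_p3 leqNgt => /negP[].
have two_le: 2 ^ 1 <= 2 ^ c by rewrite leq_exp2l.
exact: leq_trans (leq_mul two_le r_ge5).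
Qed.

Lemma odd_prime_facts q : q \in [:: p; r] -> [/\ prime q, p <= q, q != 2 & (#|G|`_q)%N = q].
Proof.
rewrite !inE => /orP[] /eqP->; first by rewrite p_pr leqnn neq_p2 card_G_p.
by rewrite r_pr (ltnW ltpr) neq_r2 oGr.
Qed.

(** No element [e] of [E] centralises a Sylow subgroup [Q]: otherwise [E] lies in the
    centraliser ['N_G(Q)] of [e] and has order at most 4, while its order exceeds [q > 3]. So
    the stabiliser in [E] of a Sylow subgroup acts faithfully on it and has order at most 2, and
    the orbits of [E] have length [#|E|] or [#|E| / 2]. Hence [#|E| / 2] divides [2 ^ c * r],
    and so [2 ^ c]. Since [2 ^ c < p <= q] and [#|E|] is 1 modulo [q], this leaves only
    [#|E| = q.+1 = 2 ^ c.+1]. *)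
Lemma no_regular_abelem (q : nat) (E Y : {group gT}) :
    q \in [:: p; r] -> #|Y| = q -> E \subset G -> 2.-abelem E -> E :!=: 1 ->
    Y \subset 'N(E) -> 'C_E(Y) = 1 ->
  False.
Proof.
move=> pr_q oY sEG abE ntE nEY regE; have [q_pr le_pq neq_q2 _] := odd_prime_facts pr_q.
have pE := abelem_pgroup abE; have cEE := abelem_abelian abE.
have E_mod: #|E| %% q = 1%N.
  have qY: q.-group Y by rewrite /pgroup oY pnat_id.
  have actE: [acts Y, on E | 'J] by rewrite astabsJ.
  by rewrite (pgroup_fix_mod qY actE) afixJ regE cards1 modn_small ?prime_gt1.
have E_gt1: 1 < #|E| by rewrite cardG_gt1.
have E_gtq: q < #|E|.
  rewrite ltn_neqAle; apply/andP; split.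
    by apply: contra_eqN E_mod => /eqP <-; rewrite modnn.
  by rewrite leqNgt; apply: contraTN E_gt1 => lt_Eq; rewrite -E_mod modn_small // ltnn.
have regQ (Q : {group gT}) : p.-Sylow(G) Q -> 'C_E(Q) = 1.
  move=> sylQ; apply/eqP; apply: contraT => /trivgPn[e /setIP[Ee cQe] nte].
  have oe: #[e] = 2 := abelem_order_p abE Ee nte.
  have Ge := subsetP sEG e Ee.
  have sEN: E \subset 'N_G(Q).
    rewrite -(cent1_involution sylQ _ oe) ?in_setI ?Ge //.
    by rewrite subsetI sEG sub_cent1 (subsetP cEE).
  have := abelem_norm_le4 sylQ abE sEN; rewrite leqNgt => /negP[].
  exact: leq_ltn_trans p_gt3 (leq_ltn_trans le_pq E_gtq).
have [f oE] := p_natP pE.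
have f_gt0: 0 < f by case: posnP => // f0; move: E_gt1; rewrite oE f0.
have dv_half: 2 ^ f.-1 %| #|'Syl_p(G)|.
  rewrite -(acts_sum_card_orbit (Syl_actsJ p sEG)); apply: dvdn_sum => X /imsetP[Q].
  rewrite inE => sylQ ->{X}; rewrite card_orbit astab1JG.
  have abN := abelemS (subsetIl E 'N(Q)) abE.
  have le2: #|'N_E(Q)| <= 2.
    apply: (@abelem_faithful_le2 Q 'N_E(Q)%G) abN (subsetIr _ _) _ => //.
    by apply/trivgP; rewrite -(regQ Q sylQ) setSI ?subsetIl.
  have := Lagrange (subsetIl E 'N(Q)); rewrite oE -(prednK f_gt0) expnS.
  case: (ltngtP #|'N_E(Q)| 2) le2 => [lt2 _ | // | -> _ /eqP].
    have -> : #|'N_E(Q)| = 1%N by apply/eqP; rewrite eqn_leq -ltnS lt2 cardG_gt0.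
    by rewrite mul1n => ->; rewrite dvdn_mull.
  by rewrite eqn_pmul2l // => /eqP->.
have le_fc: f.-1 <= c.
  rewrite -(dvdn_Pexp2l _ _ (isT : 1 < 2)); move: dv_half; rewrite def_n Gauss_dvdl //.
  by rewrite coprimeXl // prime_coprime // dvdn_prime2 // eq_sym neq_r2.
have c_lt := two_c_lt.
have fc: f = c.+1.
  apply/eqP; rewrite eqn_leq -ltnS -{1}(prednK f_gt0) !ltnS le_fc /=.
  by rewrite -(ltn_exp2l _ _ (isT : 1 < 2)) -oE (ltn_trans c_lt) // (leq_ltn_trans le_pq).
have oEq: q.+1 = (2 ^ c.+1)%N.
  rewrite -fc -oE; apply/esym/(modn1_between E_gtq) => //.
  by rewrite oE fc expnS ltn_pmul2l // (leq_trans c_lt).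
have n_mod := card_Syl_mod G p_pr; have n_le := few; rewrite def_n in n_mod n_le.
move: pr_q oEq; rewrite !inE => /orP[] /eqP-> oEq.
  exact: twin_degree_absurd p_pr r_pr p_gt3 ltpr odd_r oEq n_mod n_le.
exact: mersenne_degree_absurd p_pr odd_p odd_r ltpr oEq n_mod n_le.
Qed.

Lemma Sylow2_neq1 (S : {group gT}) : 2.-Sylow(G) S -> S :!=: 1.
Proof. exact: Sylow_neq1. Qed.

Lemma primes_proper q (M : {group gT}) :
    q \in [:: p; r] -> M \proper G -> q %| #|M| ->
  forall s, prime s -> s %| #|M| -> s \in [:: 2; q].
Proof.
move=> pr_q prM q_dv_M s s_pr s_dv; have no_pr := no_pr_subgroup prM.
have := prime_dvd_G s_pr (dvdn_trans s_dv (cardSg (proper_sub prM))); rewrite !inE.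
move: pr_q q_dv_M; rewrite !inE => /orP[] /eqP-> q_dv.
  case/or3P=> [-> | -> | /eqP eq_sr]; rewrite ?orbT //.
  by have := no_pr q_dv; rewrite -eq_sr s_dv.
case/or3P=> [-> | /eqP eq_sp | ->]; rewrite ?orbT //.
by have := no_pr; rewrite -eq_sp s_dv q_dv => /(_ isT).
Qed.

(** Otherwise let [M] be a maximal subgroup containing [L]. The odd part of its Fitting subgroup
    [F] is a normal [q]-subgroup of [M], so it is trivial and [F] is a nontrivial 2-group with
    normaliser [M]. If [S] is a Sylow 2-subgroup containing [F], then the centre of [S] lies in
    ['C_M(F)], hence in the centre of [F]. A central involution [z] of [S] lies in the
    elementary abelian group [E0] of elements of order at most 2 there; as [Y] does not
    centralise [z], the commutator of [E0] and [Y] is a nontrivial group on which [Y] acts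
    without fixed points, contrary to [no_regular_abelem]. *)
Lemma proper_sub_norm (q : nat) (Y L : {group gT}) :
    q \in [:: p; r] -> q.-Sylow(G) Y -> L \proper G -> Y \subset L ->
  L \subset 'N(Y).
Proof.
move=> pr_q sylY prL sYL; have [q_pr _ neq_q2 oGq] := odd_prime_facts pr_q.
have oY: #|Y| = q by rewrite (card_Hall sylY).
apply: contraT => not_nYL.
have [M maxM sLM] : {M : {group gT} | [max M of H | H \proper G] & L \subset M}.
  exact: maxgroup_exists.
have [prM maxMP] := maxgroupP maxM.
have sMG := proper_sub prM; have sYM := subset_trans sYL sLM.
have not_nYM: ~~ (M \subset 'N(Y)) := contra (subset_trans sLM) not_nYL.
have sylYM := pHall_subl sYM sMG sylY.
have q_dv_M: q %| #|M| by rewrite -oY cardSg.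
have solM := solG prM; pose F := 'F(M)%G.
have nsFM: F <| M := Fitting_normal M.
have pM := primes_proper pr_q prM q_dv_M.
have W1: 'O_2^'(F) = 1.
  set W := 'O_2^'(F); have nsW: W <| M by apply: gFnormal_trans.
  have qW: q.-group W.
    apply/pgroupP=> s s_pr s_dv.
    have := pgroupP (pcore_pgroup 2^' F) s s_pr s_dv.
    have := pM s s_pr (dvdn_trans s_dv (cardSg (normal_sub nsW))).
    by rewrite !inE => /orP[->|->].
  have sWY: W \subset Y.
    by apply: subset_trans (pcore_max qW nsW) (pcore_sub_Hall sylYM).
  apply: contraNeq not_nYM => ntW.
  have -> : Y :=: W.
    have [_ q_dv_W _] := pgroup_pdiv qW ntW.
    by apply/esym/eqP; rewrite eqEcard sWY oY dvdn_leq.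
  exact: normal_norm.
have pF: 2.-group F.
  have := nilpotent_pcoreC 2 (Fitting_nil M); rewrite -/F W1 dprodg1 => <-.
  exact: pcore_pgroup.
have ntY: Y :!=: 1 by rewrite -cardG_gt1 oY prime_gt1.
have ntF: F :!=: 1.
  by rewrite trivg_Fitting //; apply: contraNneq ntY => M1; rewrite -subG1 -M1.
have sFM := normal_sub nsFM; have sFG := subset_trans sFM sMG.
have defM: 'N_G(F) = M.
  apply: maxMP; last by rewrite subsetI sMG normal_norm.
  by rewrite norm_eq_simple // (sub_proper_trans sFM).
have [S sylS sFS] := Sylow_superset sFG pF.
have [sSG pS _] := and3P sylS.
have sZF: 'Z(S) \subset 'Z(F).
  have cZF: 'Z(S) \subset 'C(F).
    by rewrite (subset_trans (subsetIr _ _)) ?centS.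
  rewrite subsetI cZF andbT; apply: subset_trans (cent_sub_Fitting solM).
  rewrite subsetI cZF andbT -defM subsetI (subset_trans (center_sub S)) //=.
  exact: cents_norm.
have [z Zz oz] : exists2 z, z \in 'Z(S) & #[z] = 2.
  have ntZ: 'Z(S) != 1.
    apply: contraNneq (Sylow2_neq1 sylS) => Z1.
    exact/eqP/(trivg_center_pgroup pS Z1).
  have [_ even_Z _] := pgroup_pdiv (pgroupS (center_sub S) pS) ntZ.
  by have [z] := Cauchy (isT : prime 2) even_Z; exists z.
have ntz: z != 1 by rewrite -order_eq1 oz.
pose E0 := 'Ohm_1('Z(F))%G.
have pZ: 2.-group 'Z(F) := pgroupS (center_sub F) pF.
have abE0: 2.-abelem E0 by rewrite Ohm1_abelem ?center_abelian.
have nE0Y: Y \subset 'N(E0).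
  by rewrite (subset_trans sYM) // !gFnorm_trans // normal_norm.
have E0z: z \in E0.
  by rewrite /= (OhmE 1 pZ) mem_gen // inE (subsetP sZF) //= inE -oz expg_order.
pose E := [~: E0, Y]%G.
have sEE0: E \subset E0 by rewrite commg_subl.
have sE0G: E0 \subset G.
  by rewrite (subset_trans (Ohm_sub 1 _)) // (subset_trans (center_sub F)).
have co_E0Y: coprime #|E0| #|Y|.
  rewrite (pnat_coprime (abelem_pgroup abE0)) // oY p'natE //.
  by rewrite dvdn_prime2 // eq_sym.
suff: False by []; apply: (@no_regular_abelem q E Y) => //.
- exact: subset_trans sEE0 sE0G.
- exact: abelemS sEE0 abE0.
- apply/eqP=> /commG1P cE0Y.
  have sYS: Y \subset S.
    rewrite -(cent1_center_Sylow2 sylS Zz ntz) subsetI (subset_trans sYM) //=.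
    by rewrite sub_cent1 (subsetP cE0Y).
  have := pgroupP (pgroupS sYS pS) q q_pr; rewrite oY => /(_ (dvdnn q)).
  by rewrite inE (negPf neq_q2).
- exact: commg_normr.
exact: coprime_abel_cent_TI nE0Y co_E0Y (abelem_abelian abE0).
Qed.

Lemma norm_odd_Sylow_factor q (Y U : {group gT}) :
  q \in [:: p; r] -> q.-Sylow(G) Y -> 2.-Sylow('N_G(Y)) U -> Y * U = 'N_G(Y).
Proof.
move=> pr_q sylY sylU; have [q_pr _ neq_q2 oGq] := odd_prime_facts pr_q.
have sYN: Y \subset 'N_G(Y) by rewrite subsetI (pHall_sub sylY) normG.
have q_dv: q %| #|'N_G(Y)| by rewrite -{1}oGq -(card_Hall sylY) cardSg.
have q_dvG: q %| #|G| := dvdn_trans q_dv (cardSg (subsetIl _ _)).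
have prN := norm_Sylow_proper q_pr q_dvG sylY.
apply: (normal_Sylow_factor q_pr neq_q2 (primes_proper pr_q prN q_dv) _ sylU).
exact: pHall_subl sYN (subsetIl _ _) sylY.
Qed.

(** * Counting the conjugates of a central involution *)

Section Counting.

Variables (S : {group gT}) (z : gT).
Hypotheses (sylS : 2.-Sylow(G) S) (Zz : z \in 'Z(S)) (oz : #[z] = 2).
Let K := z ^: G.

Lemma class_sub x : x \in K -> x \in G.
Proof.
apply: subsetP; rewrite class_subG // (subsetP (pHall_sub sylS)) //.
by case/setIP: Zz.
Qed.

Lemma order_class x : x \in K -> #[x] = 2.
Proof. by case/imsetP=> g _ ->; rewrite orderJ. Qed.

Lemma class_neq1 x : x \in K -> x != 1.
Proof. by move/order_class=> ox; rewrite -order_eq1 ox. Qed.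

Lemma Sylow_cent1_class x : x \in K -> 2.-Sylow(G) 'C_G[x].
Proof.
case/imsetP=> g Gg ->; have ntz: z != 1 by rewrite -order_eq1 oz.
have -> : 'C_G[z ^ g] = 'C_G[z] :^ g by rewrite conjIg conjGid // cent1J.
by rewrite (cent1_center_Sylow2 sylS Zz ntz) pHallJ.
Qed.

Lemma not_cent_class q x (Y : {group gT}) :
  q \in [:: p; r] -> q.-Sylow(G) Y -> x \in K -> x \notin 'C(Y).
Proof.
move=> pr_q sylY Kx; have [q_pr _ neq_q2 oGq] := odd_prime_facts pr_q.
have oY: #|Y| = q by rewrite (card_Hall sylY).
apply: contraL neq_q2; rewrite -sub_cent1 => cxY; rewrite negbK.
have sYC: Y \subset 'C_G[x] by rewrite subsetI (pHall_sub sylY).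
have pC := pHall_pgroup (Sylow_cent1_class Kx).
by have /pgroupP/(_ q q_pr) := pgroupS sYC pC; rewrite oY => /(_ (dvdnn q)).
Qed.

(** A subgroup [Y] of order [p] or [r] normalising [X] would itself be normalised by [X], by
    [proper_sub_norm], so it would commute with [X] and in particular with [x]. *)
Lemma norm_2group x (X : {group gT}) :
  x \in K -> x \in X -> X \subset G -> 2.-group X -> 2.-group 'N_G(X).
Proof.
move=> Kx Xx sXG pX; have ntX: X :!=: 1.
  by apply/trivgPn; exists x; rewrite ?(class_neq1 Kx).
have prX: X \proper G.
  have [T sylT sXT] := Sylow_superset sXG pX.
  exact: sub_proper_trans sXT (Sylow_proper sylT).
have prN := norm_eq_simple ntX prX; have sNG := proper_sub prN.
apply/pgroupP=> s s_pr s_dv.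
have := prime_dvd_G s_pr (dvdn_trans s_dv (cardSg sNG)).
rewrite in_cons => /orP[//|pr_s]; have [_ _ neq_s2 oGs] := odd_prime_facts pr_s.
have [Y sylYN] := Sylow_exists s 'N_G(X).
have sylY := prime_Sylow_sub s_pr oGs sNG s_dv sylYN.
have nYN := proper_sub_norm pr_s sylY prN (pHall_sub sylYN).
have nYX: X \subset 'N(Y).
  by apply: subset_trans nYN; rewrite subsetI sXG normG.
have nXY: Y \subset 'N(X) := subset_trans (pHall_sub sylYN) (subsetIr _ _).
case/negP: (not_cent_class pr_s sylY Kx); apply: (subsetP _ x Xx).
apply/commG1P/trivgP; rewrite /= -(@coprime_TIg _ X Y).
  by rewrite subsetI commg_subl nXY commg_subr.
have [k ->] := p_natP pX; rewrite coprimeXl // (card_Hall sylY) oGs.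
by rewrite prime_coprime // dvdn_prime2 // eq_sym.
Qed.

(** Among the other Sylow 2-subgroups containing [x] take one, [A], whose intersection [X] with
    ['C_G[x]] is largest. The normaliser of [X] is a 2-group, in a Sylow subgroup [B] that
    meets ['C_G[x]] in more than [X], as normalisers grow in 2-groups; so [B] is ['C_G[x]], and
    then [A] meets it in more than [X]. *)
Lemma class_Sylow_unique x (T : {group gT}) :
  x \in K -> 2.-Sylow(G) T -> x \in T -> T :=: 'C_G[x].
Proof.
move=> Kx sylT Tx; pose C := 'C_G[x]%G; have sylC := Sylow_cent1_class Kx.
have Cx: x \in C by rewrite in_setI (class_sub Kx) cent1id.
apply/eqP; apply: contraT => neqTC.
pose bad (A : {group gT}) := [&& 2.-Sylow(G) A, x \in A & A :!=: C].
have badT: bad T by rewrite /bad sylT Tx.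
case: (arg_maxnP (fun A : {group gT} => #|C :&: A|) badT) => {badT neqTC} A.
case/and3P=> sylA Ax neqAC maxA {T sylT Tx}; pose X := (C :&: A)%G.
have [sAG pA _] := and3P sylA; have [sCG pC _] := and3P sylC.
have sXG: X \subset G by rewrite subIset ?sCG.
have pX: 2.-group X := pgroupS (subsetIl C A) pC.
have Xx: x \in X by rewrite in_setI Cx.
have pN := norm_2group Kx Xx sXG pX.
have [B sylB sNB] := Sylow_superset (subsetIl G 'N(X)) pN.
have oCA: #|C| = #|A| by rewrite (card_Hall sylC) (card_Hall sylA).
have prXC: X \proper C.
  rewrite properEneq subsetIl andbT; apply: contra neqAC => /eqP eqXC.
  by rewrite eq_sym eqEcard -oCA leqnn andbT -eqXC subsetIr.
have prXA: X \proper A.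
  rewrite properEneq subsetIr andbT; apply: contra neqAC => /eqP eqXA.
  by rewrite eqEcard oCA leqnn andbT -eqXA subsetIl.
have Bx: x \in B.
  by rewrite (subsetP sNB) // in_setI (class_sub Kx) (subsetP (normG X)).
have eqBC: B :=: C.
  apply/eqP; apply: contraT => neqBC.
  have: #|C :&: B| <= #|X| by apply: maxA; rewrite /bad sylB Bx neqBC.
  rewrite leqNgt proper_card //=.
  apply: (proper_sub_trans (nilpotent_proper_norm (pgroup_nil pC) prXC)).
  by rewrite subsetI subsetIl (subset_trans _ sNB) ?setSI.
have := nilpotent_proper_norm (pgroup_nil pA) prXA.
rewrite properE => /andP[_ /negP[]].
by rewrite subsetI subsetIl andbT -eqBC (subset_trans _ sNB) ?setSI.
Qed.

(** If [y = x ^ g], then [g] normalises the Sylow subgroup ['C_G[x]], which is its own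
    normaliser. *)
Lemma class_cent1_eq x y : x \in K -> y \in K -> y \in 'C_G[x] -> y = x.
Proof.
move=> Kx Ky Cy; have sylC := Sylow_cent1_class Kx.
have [g Gg def_y] : exists2 g, g \in G & y = x ^ g.
  have/imsetP[a Ga def_x] := Kx; have/imsetP[b Gb ->] := Ky.
  exists (a^-1 * b); first by rewrite groupM ?groupV.
  by rewrite def_x -conjgM mulKVg.
have eqC := class_Sylow_unique Ky sylC Cy.
have nCg: g \in 'N_G('C_G[x]).
  by rewrite in_setI Gg inE conjIg conjGid // -cent1J -def_y -eqC /=.
have sNC: 'N_G('C_G[x]) \subset 'C_G[x].
  have Cx: x \in 'C_G[x] by rewrite in_setI (class_sub Kx) cent1id.
  have pN := @norm_2group x 'C_G[x]%G Kx Cx (pHall_sub sylC) (pHall_pgroup sylC).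
  have sCN : 'C_G[x] \subset 'N_G('C_G[x]) by rewrite subsetI subsetIl normG.
  by rewrite (sub_pHall sylC pN sCN (subsetIl _ _)).
have /setIP[_ /cent1P cxg] := subsetP sNC g nCg.
by rewrite def_y /conjg -cxg mulKg.
Qed.

(** A conjugate of [y] under ['N_G(Y)] lies in the same Sylow 2-subgroup [U] of ['N_G(Y)] as
    [x], hence equals [x]. As [U] centralises [x] and ['N_G(Y) = Y * U], conjugation by an
    element of [Y] suffices. *)
Lemma class_norm_Sylow_conj q (Y : {group gT}) x y :
    q \in [:: p; r] -> q.-Sylow(G) Y -> x \in K -> y \in K ->
    x \in 'N(Y) -> y \in 'N(Y) ->
  exists2 t, t \in Y & y = x ^ t.
Proof.
move=> pr_q sylY Kx Ky nYx nYy; have [q_pr _ neq_q2 oGq] := odd_prime_facts pr_q.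
have [Gx Gy] := (class_sub Kx, class_sub Ky).
have p_elt u : u \in K -> 2.-group <[u]>.
  by move=> Ku; rewrite /pgroup -orderE (order_class Ku).
have [U sylU] : {U : {group gT} | 2.-Sylow('N_G(Y)) U & <[x]> \subset U}.
  by apply: Sylow_superset (p_elt x Kx); rewrite cycle_subG in_setI Gx.
rewrite cycle_subG => Ux; have [sUN pU _] := and3P sylU.
have defN := norm_odd_Sylow_factor pr_q sylY sylU.
have [g Ng sygU] : exists2 g, g \in 'N_G(Y) & <[y]> :^ g \subset U.
  by apply: Sylow_Jsub sylU _ (p_elt y Ky); rewrite cycle_subG in_setI Gy.
have [T sylT sUT] := Sylow_superset (subset_trans sUN (subsetIl _ _)) pU.
have defT := class_Sylow_unique Kx sylT (subsetP sUT x Ux).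
rewrite -cycleJ cycle_subG in sygU; have [Gg _] := setIP Ng.
have eqx: y ^ g = x.
  apply: class_cent1_eq => //; first by rewrite /K -(class_eqP Ky) memJ_class.
  by rewrite -defT (subsetP sUT).
have sUC: U \subset 'C_G[x] by rewrite -defT.
rewrite -defN in Ng; case/mulsgP: Ng => t u Yt Uu def_g.
exists t^-1; first by rewrite groupV.
have: u^-1 \in 'C[x] by rewrite groupV; case/setIP: (subsetP sUC u Uu).
rewrite cent1C => /cent1P/commgP/conjg_fixP fix_x.
by rewrite -(conjgK g y) eqx def_g invMg conjgM fix_x.
Qed.

(** [x] and [y] invert [x * y], so they would generate a group with a nontrivial proper normal
    subgroup or an abelian group. *)
Lemma class_gen_proper x y : x \in K -> y \in K -> <<[set x; y]>> \proper G.
Proof.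
move=> Kx Ky; have [Gx Gy] := (class_sub Kx, class_sub Ky).
have sDG: <<[set x; y]>> \subset G by rewrite gen_subG subUset !sub1set Gx.
rewrite properEneq sDG andbT; apply: contra ncG => /eqP defG.
have sq u : u \in K -> u * u = 1.
  by move/order_class=> ou; rewrite -[u * u]/(u ^+ 2) -ou expg_order.
have inv u : u \in K -> u^-1 = u.
  by move=> Ku; apply/eqP; rewrite eq_invg_mul sq.
have nx: (x * y) ^ x = (x * y)^-1.
  by rewrite conjgE invMg !inv // !mulgA sq // mul1g.
have ny: (x * y) ^ y = (x * y)^-1.
  by rewrite conjgE invMg !inv // -(mulgA x) sq // mulg1.
have nsC: <[x * y]> <| G.
  rewrite /normal cycle_subG groupM //= -defG gen_subG subUset !sub1set.
  by rewrite !inE -!cycleJ nx ny cycleV subxx.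
have [_ /(_ _ nsC)[/eqP | defC]] := simpleP _ simG; last first.
  by rewrite -defC cycle_abelian.
rewrite cycle_eq1 -eq_invg_mul inv // => /eqP eq_xy.
by rewrite -defG -eq_xy setUid -/(<[x]>) cycle_abelian.
Qed.

Lemma class_pair x y : x \in K -> y \in K -> y != x ->
  exists q, exists2 Y : {group gT}, q \in [:: p; r] /\ q.-Sylow(G) Y &
    x \in 'N(Y) /\ x^-1 * y \in Y^#.
Proof.
move=> Kx Ky neq_yx; set D := <<[set x; y]>>.
have prD: D \proper G by apply: class_gen_proper.
have sDG := proper_sub prD.
have [Dx Dy]: x \in D /\ y \in D by rewrite !mem_gen // !inE eqxx ?orbT.
have [s pr_s s_dv]: exists2 s, s \in [:: p; r] & s %| #|D|.
  have [/hasP[s] | no_pr] := boolP (has (fun s => s %| #|D|) [:: p; r]).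
    by exists s.
  have pD: 2.-group D.
    apply/pgroupP=> s s_pr s_dv.
    have := prime_dvd_G s_pr (dvdn_trans s_dv (cardSg sDG)).
    rewrite in_cons => /orP[// | pr_s].
    by case/hasP: no_pr; exists s.
  have [T sylT sDT] := Sylow_superset sDG pD.
  have eqT := class_Sylow_unique Kx sylT (subsetP sDT x Dx).
  by rewrite (class_cent1_eq Kx Ky) ?eqxx // -?eqT ?(subsetP sDT) in neq_yx.
have [s_pr _ _ oGs] := odd_prime_facts pr_s; have [Y sylYD] := Sylow_exists s D.
have sylY := prime_Sylow_sub s_pr oGs sDG s_dv sylYD.
have nYD := proper_sub_norm pr_s sylY prD (pHall_sub sylYD).
have [nYx nYy] := (subsetP nYD x Dx, subsetP nYD y Dy).
have [t Yt def_y] := class_norm_Sylow_conj pr_s sylY Kx Ky nYx nYy.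
exists s; exists Y => //; split=> //; rewrite in_setD1 -eq_mulVg1 eq_sym neq_yx.
by rewrite def_y -commgEl commgEr groupM // memJ_norm ?groupV.
Qed.

(** [x] centralises no nontrivial element of [Y], so every element of [Y] is a commutator
    [[~ x, t]] with [t] in [Y]. *)
Lemma class_norm_coset q (Y : {group gT}) x w :
  q \in [:: p; r] -> q.-Sylow(G) Y -> x \in K -> x \in 'N(Y) -> w \in Y ->
  x * w \in K.
Proof.
move=> pr_q sylY Kx nYx Yw; have [q_pr _ neq_q2 oGq] := odd_prime_facts pr_q.
have oY: #|Y| = q by rewrite (card_Hall sylY).
have sylC := Sylow_cent1_class Kx.
have regx t : t \in Y -> t \in 'C[x] -> t = 1.
  move=> Yt cxt; have tiYC: Y :&: 'C_G[x] = 1.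
    apply: coprime_TIg; have [k ->] := p_natP (pHall_pgroup sylC).
    by rewrite coprimeXr // oY prime_coprime // dvdn_prime2.
  apply/set1P; rewrite -[[set 1]]tiYC in_setI Yt in_setI cxt andbT.
  exact: subsetP (pHall_sub sylY) t Yt.
have injf: {in Y &, injective (fun t => [~ x, t])}.
  move=> t1 t2 Yt1 Yt2 /=; rewrite !commgEl => /mulgI eq_xt.
  apply/eqP; rewrite eq_mulgV1; apply/eqP/regx; first by rewrite groupM ?groupV.
  rewrite cent1C; apply/cent1P/commgP/conjg_fixP.
  by rewrite conjgM eq_xt -conjgM mulgV conjg1.
have imf: [set [~ x, t] | t in Y] = Y.
  apply/eqP; rewrite eqEcard card_in_imset // leqnn andbT.
  apply/subsetP=> _ /imsetP[t Yt ->].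
  by rewrite commgEr groupM // memJ_norm ?groupV.
move: Yw; rewrite -{1}imf => /imsetP[t Yt ->].
rewrite commgEl mulKVg /K -(class_eqP Kx) memJ_class //.
exact: subsetP (pHall_sub sylY) t Yt.
Qed.

Let F q x := [set Y in 'Syl_q(G) | x \in 'N((Y : {group gT}))].

Lemma mem_normalised_Syl q x (Y : {group gT}) :
  (Y \in F q x) = q.-Sylow(G) Y && (x \in 'N(Y)).
Proof. by rewrite 2!in_set. Qed.

Lemma card_class : #|K| = (p * r)%N.
Proof.
have ntz: z != 1 by rewrite -order_eq1 oz.
rewrite -index_cent1 (cent1_center_Sylow2 sylS Zz ntz) -divgS ?(pHall_sub sylS) //.
by rewrite {1}card_G (card_Hall sylS) mulKn // part_gt0.
Qed.

(** By [class_pair] and [class_norm_coset] the conjugates of [x] other than [x] are the products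
    [x * w], where [w] is a nontrivial element of a subgroup of order [p] or [r] normalised by
    [x]. *)
Lemma class_equation x : x \in K ->
  (p * r = (#|F p x| * p.-1 + #|F r x| * r.-1).+1)%N.
Proof.
move=> Kx; pose W q := \bigcup_(Y in F q x) Y^#.
have oW q : q \in [:: p; r] -> #|W q| = (#|F q x| * q.-1)%N.
  move=> pr_q; have [q_pr _ _ oGq] := odd_prime_facts pr_q.
  apply: card_bigcup_prime => // Y; rewrite !inE => /andP[sylY _].
  by rewrite (card_Hall sylY).
have defW: W p :|: W r = [set x^-1 * y | y in K :\ x].
  apply/setP=> w; apply/idP/imsetP=> [Ww | [y /setD1P[neq_yx Ky] ->]].
    have [q pr_q /bigcupP[Y]]: exists2 q, q \in [:: p; r] & w \in W q.
      by case/setUP: Ww => Ww; [exists p | exists r]; rewrite // !inE eqxx ?orbT.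
    rewrite !inE => /andP[sylY nYx] /andP[ntw Yw]; exists (x * w); last first.
      by rewrite mulKg.
    have Kxw: x * w \in K by apply: class_norm_coset pr_q sylY Kx _ Yw; rewrite inE.
    by rewrite in_setD1 Kxw andbT -[X in _ != X]mulg1 (inj_eq (mulgI x)).
  have [q [Y [pr_q sylY] [nYx Yw]]] := class_pair Kx Ky neq_yx.
  have: x^-1 * y \in W q by apply/bigcupP; exists Y; rewrite // inE inE sylY.
  by move: pr_q; rewrite !inE => /orP[] /eqP-> ->; rewrite ?orbT.
have dis: W p :&: W r = set0.
  apply/setP=> w; rewrite in_setI in_set0; apply/andP=> -[].
  case/bigcupP=> Y; rewrite !inE => /andP[sylY _] /andP[ntw Yw].
  case/bigcupP=> R; rewrite !inE => /andP[sylR _] /andP[_ Rw].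
  case/negP: ntw; rewrite -order_eq1 -dvdn1.
  have <- : gcdn p r = 1%N.
    by apply/eqP; rewrite -/(coprime p r) prime_coprime // dvdn_prime2 // ltn_eqF.
  rewrite dvdn_gcd -{1}(card_p_Sylow sylY) -(card_r_Sylow sylR).
  by rewrite !order_dvdG.
have := cardsU (W p) (W r); rewrite dis cards0 subn0 defW !oW ?inE ?eqxx ?orbT //.
rewrite card_imset; last exact: mulgI.
by rewrite -card_class (cardsD1 x K) Kx add1n => ->.
Qed.

(** By [class_norm_Sylow_conj] the centraliser of [x] permutes [F q x] transitively, and the
    stabiliser of [Y] is a Sylow 2-subgroup of ['N_G(Y)]. *)
Lemma card_normalised_Syl q q' x : q \in [:: p; r] -> (q * q' = p * r)%N -> x \in K ->
  #|F q x| = 0 \/ (#|F q x| * q' = #|'Syl_q(G)|)%N.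
Proof.
move=> pr_q def_qq' Kx; have [q_pr _ neq_q2 oGq] := odd_prime_facts pr_q.
have [-> | [Y]] := set_0Vmem (F q x); first by left; rewrite cards0.
rewrite mem_normalised_Syl => /andP[sylY nYx]; right.
have oY: #|Y| = q by rewrite (card_Hall sylY).
have Gx := class_sub Kx; have sylC := Sylow_cent1_class Kx.
have sCG := pHall_sub sylC.
have defF: F q x = orbit 'JG%act 'C_G[x] Y.
  apply/setP=> Y'; rewrite mem_normalised_Syl; apply/andP/orbitP=> [[sylY' nY'x] | [h Ch <-]].
    have [g Gg def_Y'] := Sylow_trans sylY sylY'.
    have nY'xg: x ^ g \in 'N(Y') by rewrite def_Y' normJ memJ_conjg.
    have Kxg: x ^ g \in K by rewrite /K -(class_eqP Kx) memJ_class.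
    have [t Y't def_x] := class_norm_Sylow_conj pr_q sylY' Kxg Kx nY'xg nY'x.
    have Gt := subsetP (pHall_sub sylY') t Y't.
    exists (g * t).
      rewrite in_setI groupM //= cent1C; apply/cent1P/commgP/conjg_fixP.
      by rewrite conjgM -def_x.
    by apply/val_inj; rewrite /= conjsgM -def_Y' conjGid.
  have [Gh cxh] := setIP Ch; rewrite pHallJ //; split=> //.
  move: cxh; rewrite cent1C => /cent1P/commgP/conjg_fixP <-.
  by rewrite /= normJ memJ_conjg.
have oF: #|F q x| = #|'C_G[x] : 'N_('C_G[x])(Y)|.
  by rewrite defF card_orbit astab1JG.
have [U sylU] : {U : {group gT} | 2.-Sylow('N_G(Y)) U & <[x]> \subset U}.
  apply: Sylow_superset; first by rewrite cycle_subG in_setI Gx.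
  by rewrite /pgroup -orderE (order_class Kx).
rewrite cycle_subG => Ux; have [sUN pU _] := and3P sylU.
have [sUG nYU] := subsetIP sUN.
have defU: U :=: 'N_('C_G[x])(Y).
  have [T sylT sUT] := Sylow_superset sUG pU.
  have defT := class_Sylow_unique Kx sylT (subsetP sUT x Ux).
  have sUCN: U \subset 'N_('C_G[x])(Y).
    by rewrite subsetI nYU andbT (subset_trans sUT) ?defT.
  have pCN: 2.-group 'N_('C_G[x])(Y) := pgroupS (subsetIl _ _) (pHall_pgroup sylC).
  exact/esym/(sub_pHall sylU pCN sUCN (setSI _ sCG)).
have oN: #|'N_G(Y)| = (q * #|U|)%N.
  rewrite -(norm_odd_Sylow_factor pr_q sylY sylU) coprime_cardMg ?oY //.
  have [k ->] := p_natP pU.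
  by rewrite coprimeXr // prime_coprime // dvdn_prime2.
have := Lagrange (subsetIl G 'N(Y)); rewrite oN -(card_Syl sylY).
have oC: (#|U| * #|F q x|)%N = #|'C_G[x]| by rewrite oF defU Lagrange ?subsetIl.
rewrite card_G -(card_Hall sylC) -def_qq' -oC => /eqP.
rewrite [(_ * (q * q'))%N]mulnACA [(#|U| * q)%N]mulnC eqn_pmul2l => [/eqP-> //|].
by rewrite muln_gt0 prime_gt0 // cardG_gt0.
Qed.

Lemma not_central_involution : False.
Proof.
have Kz: z \in K by apply: class_refl.
have pr_p: p \in [:: p; r] by rewrite inE eqxx.
have pr_r: r \in [:: p; r] by rewrite !inE eqxx orbT.
have Fp := card_normalised_Syl pr_p (erefl _) Kz.
have Fr := card_normalised_Syl pr_r (mulnC _ _) Kz.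
have n_gt0: 0 < #|'Syl_p(G)| by apply: ltnW (Syl_gt1 p_pr p_dv_G).
apply: (class_equation_absurd p_pr r_pr (ltnW p_gt3) ltpr (class_equation Kz)).
- by case: Fp => ->; rewrite ?mul0n // few.
- case: Fp => [-> // | def_F]; apply/eqP=> F1; move: def_F.
  rewrite F1 mul1n def_n -{1}[r]mul1n => /eqP; rewrite eqn_pmul2r ?prime_gt0 //.
  by rewrite -(expn0 2) eqn_exp2l // eq_sym eqn0Ngt c_gt0.
- case: Fp => ->; [by left | right]; exact: card_Syl_mod.
by case: Fr => ->; [left | right; apply: card_Syl_mod].
Qed.

End Counting.

Lemma not_even_degree : False.
Proof.
have [S sylS] := Sylow_exists 2 G; have pS := pHall_pgroup sylS.
have ntZ: 'Z(S) != 1.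
  apply: contraNneq (Sylow2_neq1 sylS) => Z1.
  exact/eqP/(trivg_center_pgroup pS Z1).
have [_ even_Z _] := pgroup_pdiv (pgroupS (center_sub S) pS) ntZ.
have [z Zz oz] := Cauchy (isT : prime 2) even_Z.
exact: not_central_involution sylS Zz oz.
Qed.

End EvenDegree.
End TwoOddPrimes.

Lemma few_Sylow_smallest_prime_absurd :
  (forall H : {group gT}, H \proper G -> solvable H) -> False.
Proof.
move=> solG.
have [r r_pr [ltpr even_G oGr [c def_n] oG]] := order_three_primes.
have [c0 | c_gt0] := posnP c; last exact: not_even_degree def_n.
by apply: (not_prime_degree r_pr ltpr even_G oGr oG solG); rewrite def_n c0 mul1n.
Qed.

End FewSylow.
End SimpleGroup.

(** * The theorem *)

Lemma simple_few_Sylow (gT : finGroupType) (G : {group gT}) :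
    simple G -> (forall H : {group gT}, H \proper G -> solvable H) ->
    (forall p, prime p -> odd p -> #|'Syl_p(G)| <= p ^ 2) ->
  solvable G.
Proof.
move=> simG solG few; apply: contraT => nsolG.
have ncG: ~~ abelian G by apply: contra nsolG => /abelian_sol.
pose odd_div q := [&& prime q, odd q & q %| #|G|].
have ex_odd: exists q, odd_div q.
  have [/hasP[q] | no_odd] := boolP (has odd (primes #|G|)).
    by rewrite mem_primes => /and3P[q_pr _ q_dv] odd_q; exists q; apply/and3P.
  case/negP: nsolG; apply: Burnside_p_a_q_b.
  apply: (@leq_trans 1) => //; apply: (@uniq_leq_size _ _ [:: 2]) (primes_uniq _) _.
  move=> q pi_q; have := hasPn no_odd q pi_q; move: pi_q.
  rewrite mem_primes inE => /and3P[q_pr _ _].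
  by case: (even_prime q_pr) => [-> | ->].
case: (ex_minnP ex_odd) => p /and3P[p_pr odd_p p_dv] min_p.
suff: False by []; apply: (few_Sylow_smallest_prime_absurd simG ncG p_pr p_dv) => //.
  exact: few.
by move=> q q_pr odd_q q_dv; apply: min_p; apply/and3P.
Qed.

Theorem theorem1p3 (gT : finGroupType) (G : {group gT})
    (few_Sylow : forall p : nat, prime p -> odd p -> #|'Syl_p(G)%g| <= p ^ 2) :
  solvable G.
Proof.
have [n] := ubnP #|G|; elim: n => // n IHn in gT G few_Sylow *; rewrite ltnS => leGn.
have solH (H : {group gT}) : H \proper G -> solvable H.
  move=> prH; apply: IHn => [p p_pr odd_p|]; last exact: leq_trans (proper_card prH) leGn.
  exact: leq_trans (card_Syl_sub p (proper_sub prH)) (few_Sylow p p_pr odd_p).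
have [simG | ] := boolP (simple G); first exact: simple_few_Sylow.
rewrite negb_forall_in => /exists_inP[N sNG]; rewrite eq_sym.
have [->|] := eqVneq N G.
  by rewrite groupP /= genGid normG andbT eqb_id negbK => /eqP->; apply: solvable1.
rewrite [N == G]eqEproper sNG eqbF_neg !negbK => ltNG /and3P[grN].
case/isgroupP: grN => {}N -> in sNG ltNG *; rewrite /= genGid => ntN nNG.
have nsNG: N <| G by apply/andP.
rewrite (series_sol nsNG) solH //=.
apply: IHn => [p p_pr odd_p|]; last by apply: leq_trans leGn; apply: ltn_quotient.
exact: leq_trans (card_Syl_quotient p nsNG) (few_Sylow p p_pr odd_p).
Qed.
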